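(* Consider, for a parameter $\lambda\in\mathbb{R}$, the initial boundary value problem $$u_{xt}+uu_{xx}-\lambda u_x^2=I(t),\quad I(t)=-(\lambda+1)\int_0^1u_x^2\,dx,\quad t>0,\qquad u(x,0)=u_0(x),\ x\in[0,1],$$ with periodic boundary conditions $u(0,t)=u(1,t)$, $u_x(0,t)=u_x(1,t)$. There exist smooth, $1$-periodic initial data $u_0$ (so that $u_0'$ has mean zero on $[0,1]$) such that the following hold. (1) For $\lambda\in[0,1]$ the solution exists for all $t\ge0$. Moreover, for $\lambda\in(0,1)$, $u_x(\gamma(\alpha,t),t)\to0$ as $t\to+\infty$ for every $\alpha\in[0,1]$, while for $\lambda=1$, $u_x(\gamma(\alpha,t),t)$ converges as $t\to+\infty$ to a limit which is not identically zero (a non-trivial steady state). (2) For $\lambda\in(-\infty,-2]\cup(1,+\infty)$ there is a finite $t_*>0$ such that $M(t)\to+\infty$ and $m(t)\to-\infty$ as $t\uparrow t_*$, and moreover $\lim_{t\uparrow t_*}|u_x(\gamma(\alpha,t),t)|=+\infty$ for every $\alpha\notin\{\overline\alpha_i\}\cup\{\underline\alpha_j\}$ (two-sided, everywhere blow-up). (3) For $\lambda\in(-2,0)$ there is a finite $t_*>0$ such that $m(t)\to-\infty$ as $t\uparrow t_*$, while $u_x(\gamma(\alpha,t),t)$ remains bounded on $[0,t_* )$ for every $\alpha\notin\{\underline\alpha_j\}$ (one-sided, discrete blow-up: only the minimum diverges).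
   Context: For a solution $u$, $\gamma(\alpha,t)$ denotes the characteristic (Lagrangian flow map): $\dot\gamma(\alpha,t)=u(\gamma(\alpha,t),t)$, $\gamma(\alpha,0)=\alpha\in[0,1]$; $\gamma_\alpha$ is its derivative in $\alpha$ (the jacobian). $M(t)=\sup_{\alpha\in[0,1]}u_x(\gamma(\alpha,t),t)$ and $m(t)=\inf_{\alpha\in[0,1]}u_x(\gamma(\alpha,t),t)$. $M_0=\max u_0'>0$ and $m_0=\min u_0'<0$; $\overline\alpha_i$ ($1\le i\le m$) are the finitely many points of $[0,1]$ where $u_0'=M_0$, and $\underline\alpha_j$ ($1\le j\le n$) the finitely many points where $u_0'=m_0$. *)

(* Defs.v *)
From Stdlib Require Import Reals Lra List.
Open Scope R_scope.

(* Time horizon: [None] = +infinity (global solution), [Some T] = [0,T). *)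
Definition before (T : option R) (t : R) : Prop :=
  match T with None => True | Some T0 => t < T0 end.

Definition in_time (T : option R) (t : R) : Prop := 0 <= t /\ before T t.

Definition jcont_at (D : R -> Prop) (f : R -> R -> R) (x t : R) : Prop :=
  forall eps, eps > 0 -> exists delta, delta > 0 /\
    forall y s, D s -> Rabs (y - x) < delta -> Rabs (s - t) < delta ->
      Rabs (f y s - f x t) < eps.

Definition smooth (f : R -> R) : Prop :=
  exists D : nat -> R -> R, D O = f /\
    forall n x, derivable_pt_lim (D n) x (D (S n) x).

Definition periodic1 (f : R -> R) : Prop := forall x, f (x + 1) = f x.

Definition integral01 (g : R -> R) (v : R) : Prop :=
  exists pr : Riemann_integrable g 0 1, RiemannInt pr = v.

Definition is_solution (lam : R) (u0 : R -> R) (T : option R)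
    (u ux : R -> R -> R) : Prop :=
  exists uxx uxt : R -> R -> R,
    (forall x, u x 0 = u0 x) /\
    (forall x t, in_time T t -> u (x + 1) t = u x t) /\
    (forall x t, in_time T t -> derivable_pt_lim (fun y => u y t) x (ux x t)) /\
    (forall x t, in_time T t -> jcont_at (in_time T) u x t) /\
    (forall x t, in_time T t -> jcont_at (in_time T) ux x t) /\
    (forall x t, 0 < t -> before T t ->
       derivable_pt_lim (fun y => ux y t) x (uxx x t)) /\
    (forall x t, 0 < t -> before T t ->
       derivable_pt_lim (fun s => ux x s) t (uxt x t)) /\
    (forall x t, 0 < t -> before T t ->
       jcont_at (fun s => 0 < s /\ before T s) uxx x t /\
       jcont_at (fun s => 0 < s /\ before T s) uxt x t) /\
    (forall t, 0 < t -> before T t -> exists It,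
       integral01 (fun y => (ux y t)^2) It /\
       forall x, uxt x t + u x t * uxx x t - lam * (ux x t)^2 = - (lam + 1) * It).

Definition is_characteristic (T : option R) (u : R -> R -> R)
    (gamma : R -> R -> R) : Prop :=
  forall a, gamma a 0 = a /\
    (forall eps, eps > 0 -> exists delta, delta > 0 /\
       forall t, 0 <= t < delta -> before T t -> Rabs (gamma a t - a) < eps) /\
    (forall t, 0 < t -> before T t ->
       derivable_pt_lim (fun s => gamma a s) t (u (gamma a t) t)).

Definition is_max_pt (f : R -> R) (a : R) : Prop := forall x, f x <= f a.
Definition is_min_pt (f : R -> R) (a : R) : Prop := forall x, f a <= f x.

Definition finitely_many_in01 (P : R -> Prop) : Prop :=
  exists l : list R, forall a, 0 <= a <= 1 -> (P a <-> In a l).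

Definition tends_infty (g : R -> R) (L : R) : Prop :=
  forall eps, eps > 0 -> exists T0, forall t, t >= T0 -> Rabs (g t - L) < eps.

(* M(t) = sup_{a in [0,1]} ux(gamma(a,t),t) -> +oo as t -> tstar^- *)
Definition sup_to_pinfty (tstar : R) (ux gamma : R -> R -> R) : Prop :=
  forall K, exists delta, delta > 0 /\ forall t, tstar - delta < t < tstar ->
    exists a, 0 <= a <= 1 /\ ux (gamma a t) t > K.

(* m(t) = inf_{a in [0,1]} ux(gamma(a,t),t) -> -oo as t -> tstar^- *)
Definition inf_to_minfty (tstar : R) (ux gamma : R -> R -> R) : Prop :=
  forall K, exists delta, delta > 0 /\ forall t, tstar - delta < t < tstar ->
    exists a, 0 <= a <= 1 /\ ux (gamma a t) t < K.

Definition abs_to_infty_left (tstar : R) (g : R -> R) : Prop :=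
  forall K, exists delta, delta > 0 /\ forall t, tstar - delta < t < tstar ->
    Rabs (g t) > K.

(* Main.v *)
(** With u0 = sin(2 PI x)/(2 PI), the slope along characteristics solves
    V' = lam V^2 + I(t), a Riccati equation with a nonlocal forcing that can be linearised by a
    change of time. In a new parameter s, dt = N(s)^(2 lam) ds, the jacobian is w/N with
    w = (1 - lam s c)^(-1/lam) (or exp(s c) if lam = 0), c = cos(2 PI x), N = the mean of w, and
    V = N^(-2 lam) (c/(1 - lam s c) - N'/N). The solution lives on the image of s < 1/|lam|, and
    everything is decided by the growth, as mu = lam s tends to +-1, of the integrals
    P_q(mu) of (1 - mu c)^(-q) over a period, q = 1/lam, since
    mu V = P_q^(-2 lam) (1/(1 - mu c) - P_(q+1)/P_q). Integrating the derivative of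
    sin(2 PI x) (1 - mu c)^(-q) relates P_(q-1), P_q and P_(q+1), which gives the upper bounds;
    the lower bounds come from the neighbourhood of the zero of 1 - mu c. *)
From Stdlib Require Import Reals Lra List Classical ClassicalEpsilon.
From Coquelicot Require Import Coquelicot.
Require Import Defs.
Open Scope R_scope.

(** * Differentiability in two variables *)

(** The thresholds come from the quadratic vanishing of [1 - mu c] at its zero: past the critical
    exponent [q = 1/2], [P_q] is of order [(1 - |mu|)^(1/2 - q)]. For [0 < lam < 2] this makes
    [dt/ds = N^(2 lam)] of order [(1 - mu)^(lam - 2)], which is integrable exactly when [lam > 1]:
    hence global existence up to [1] and finite time beyond. For [lam < 0] and [s >= 0], [N] stays
    between positive constants, so the time is always finite, and only [P_(q+1)] matters: it is
    bounded when [q + 1 < 1/2], that is [lam > -2], and diverges (logarithmically at [lam = -2])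
    otherwise. No exact asymptotics are proved; one-sided bounds, with a slightly lossy exponent for
    [lam > 1], are enough. The construction is Lagrangian while the claim concerns an Eulerian
    solution and every characteristic of it. So the flow map has to be inverted in the label with
    joint regularity in space and time, and an arbitrary characteristic has to be identified with
    the explicit one. *)

Lemma open_interval_around (D : R -> Prop) (t : R) :
  open D -> D t -> exists d : posreal, forall s, Rabs (s - t) < d -> D s.
Proof.
  intros HD Ht. destruct (HD t Ht) as [d Hd]. exists d. intros s Hs. apply Hd. exact Hs.
Qed.

(** The increment is split along a corner: the mean value theorem on the leg in the first variable,
    the bare definition of the derivative on the leg in the second. Hence the time derivative need
    only exist at the point itself. *)
Lemma differentiable_of_partials (F Fa : R -> R -> R) (Ft x y : R) :
  locally_2d (fun u v => is_derive (fun z => F z v) u (Fa u v)) x y ->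
  continuity_2d_pt Fa x y ->
  is_derive (fun v => F x v) y Ft ->
  differentiable_pt_lim F x y (Fa x y) Ft.
Proof.
  intros [d1 H1] H2 H3 eps.
  destruct (H2 (pos_div_2 eps)) as [d2 Hd2].
  assert (H3' := proj1 (is_derive_Reals _ _ _) H3).
  destruct (H3' (eps / 2)) as [d3 Hd3]. { generalize (cond_pos eps); lra. }
  assert (Hd : 0 < Rmin d1 (Rmin d2 d3)).
  { repeat apply Rmin_pos; apply cond_pos. }
  exists (mkposreal _ Hd). simpl. intros u v Hu Hv.
  assert (Hu1 : Rabs (u - x) < d1) by (eapply Rlt_le_trans; [exact Hu|apply Rmin_l]).
  assert (Hv1 : Rabs (v - y) < d1) by (eapply Rlt_le_trans; [exact Hv|apply Rmin_l]).
  assert (Hu2 : Rabs (u - x) < d2).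
  { eapply Rlt_le_trans; [exact Hu|]. eapply Rle_trans; [apply Rmin_r|apply Rmin_l]. }
  assert (Hv2 : Rabs (v - y) < d2).
  { eapply Rlt_le_trans; [exact Hv|]. eapply Rle_trans; [apply Rmin_r|apply Rmin_l]. }
  assert (Hv3 : Rabs (v - y) < d3).
  { eapply Rlt_le_trans; [exact Hv|]. eapply Rle_trans; [apply Rmin_r|apply Rmin_r]. }
  assert (Hbetw : forall z, Rmin x u <= z <= Rmax x u -> Rabs (z - x) <= Rabs (u - x)).
  { intros z [Hz1 Hz2]. unfold Rmin, Rmax in *. destruct (Rle_dec x u);
    unfold Rabs; repeat destruct Rcase_abs; lra. }
  destruct (MVT_gen (fun z => F z v) x u (fun z => Fa z v)) as [c [Hc HcE]].
  { intros z Hz. apply H1; auto. eapply Rle_lt_trans; [apply Hbetw; lra|auto]. }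
  { intros z Hz. apply derivable_continuous_pt. exists (Fa z v). apply is_derive_Reals.
    apply H1; auto. eapply Rle_lt_trans; [apply Hbetw; lra|auto]. }
  assert (HcF : Rabs (Fa c v - Fa x y) < eps / 2).
  { apply Hd2; auto. eapply Rle_lt_trans; [apply Hbetw; lra|auto]. }
  assert (HvF : Rabs (F x v - F x y - Ft * (v - y)) <= eps / 2 * Rabs (v - y)).
  { destruct (Req_dec (v - y) 0) as [E|E].
    - replace v with y by lra. rewrite !Rminus_diag, Rmult_0_r, Rminus_0_r, !Rabs_R0. lra.
    - specialize (Hd3 (v - y) E Hv3). replace (y + (v - y)) with v in Hd3 by ring.
      replace (F x v - F x y - Ft * (v - y))
        with (((F x v - F x y) / (v - y) - Ft) * (v - y)) by (field; exact E).
      rewrite Rabs_mult. apply Rmult_le_compat_r; [apply Rabs_pos|lra]. }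
  replace (F u v - F x y - (Fa x y * (u - x) + Ft * (v - y)))
    with ((Fa c v - Fa x y) * (u - x) + (F x v - F x y - Ft * (v - y)))
    by (replace (F u v) with (F x v + Fa c v * (u - x)) by lra; ring).
  eapply Rle_trans; [apply Rabs_triang|]. rewrite Rabs_mult.
  assert (P1 := Rmax_l (Rabs (u - x)) (Rabs (v - y))).
  assert (P2 := Rmax_r (Rabs (u - x)) (Rabs (v - y))).
  assert (P3 := Rabs_pos (u - x)). assert (P4 := Rabs_pos (v - y)).
  assert (P5 := Rabs_pos (Fa c v - Fa x y)). assert (P6 := cond_pos eps).
  set (m := Rmax (Rabs (u - x)) (Rabs (v - y))) in *.
  assert (Rabs (Fa c v - Fa x y) * Rabs (u - x) <= eps / 2 * m) by (apply Rmult_le_compat; lra).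
  assert (eps / 2 * Rabs (v - y) <= eps / 2 * m) by (apply Rmult_le_compat_l; lra).
  lra.
Qed.

(** Implicit differentiation of [G (A u v) v = u]. The remainder of [G] is measured by the unknown
    increment of [A], so that increment must first be bounded linearly by those of [u] and [v];
    continuity of [A] is what brings it into the range where the expansion of [G] holds. *)
Lemma differentiable_inverse (G A : R -> R -> R) (x y p q : R) :
  differentiable_pt_lim G (A x y) y p q -> 0 < p ->
  continuity_2d_pt A x y ->
  locally_2d (fun u v => G (A u v) v = u) x y ->
  differentiable_pt_lim A x y (/ p) (- q / p).
Proof.
  intros HG Hp HA HI eps.
  assert (He := cond_pos eps).
  (* [K] is the Lipschitz constant that results when the remainder is absorbed: [e1 <= p / 2] leaves
     [p / 2 * |da| <= (1 + |q| + p / 2) * m]. The second bound in [e1] makes [e1 * (K + 1) / p] at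
     most [eps]. *)
  set (K := 2 * (1 + Rabs q) / p + 1).
  assert (HK : 0 < K).
  { unfold K. assert (0 <= 2 * (1 + Rabs q) / p).
    { apply Rmult_le_pos. generalize (Rabs_pos q); lra. left; apply Rinv_0_lt_compat; lra. } lra. }
  set (e1 := Rmin (p / 2) (eps * p / (K + 1))).
  assert (He1 : 0 < e1).
  { unfold e1. apply Rmin_pos. lra. apply Rdiv_lt_0_compat; [apply Rmult_lt_0_compat; assumption|lra]. }
  destruct (HG (mkposreal _ He1)) as [d1 H1]. simpl in H1.
  destruct (HA d1) as [d2 H2].
  destruct HI as [d3 H3].
  assert (Hd : 0 < Rmin d1 (Rmin d2 d3)).
  { repeat apply Rmin_pos; apply cond_pos. }
  exists (mkposreal _ Hd). simpl. intros u v Hu Hv.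
  assert (Hv1 : Rabs (v - y) < d1) by (eapply Rlt_le_trans; [exact Hv|apply Rmin_l]).
  assert (Hu2 : Rabs (u - x) < d2).
  { eapply Rlt_le_trans; [exact Hu|]. eapply Rle_trans; [apply Rmin_r|apply Rmin_l]. }
  assert (Hv2 : Rabs (v - y) < d2).
  { eapply Rlt_le_trans; [exact Hv|]. eapply Rle_trans; [apply Rmin_r|apply Rmin_l]. }
  assert (Hu3 : Rabs (u - x) < d3).
  { eapply Rlt_le_trans; [exact Hu|]. eapply Rle_trans; [apply Rmin_r|apply Rmin_r]. }
  assert (Hv3 : Rabs (v - y) < d3).
  { eapply Rlt_le_trans; [exact Hv|]. eapply Rle_trans; [apply Rmin_r|apply Rmin_r]. }
  specialize (H1 (A u v) v (H2 u v Hu2 Hv2) Hv1).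
  rewrite (H3 u v Hu3 Hv3) in H1.
  rewrite (H3 x y) in H1; [|rewrite Rminus_diag, Rabs_R0; apply cond_pos ..].
  set (da := A u v - A x y) in *. set (dx := u - x) in *. set (dy := v - y) in *.
  set (m := Rmax (Rabs dx) (Rabs dy)).
  assert (M1 : Rabs dx <= m) by apply Rmax_l. assert (M2 : Rabs dy <= m) by apply Rmax_r.
  assert (Hm : 0 <= m) by (generalize (Rabs_pos dx); lra).
  assert (Pa := Rabs_pos da). assert (Pq := Rabs_pos q).
  assert (Hmax : Rmax (Rabs da) (Rabs dy) <= Rabs da + m).
  { apply Rmax_lub; lra. }
  assert (L1 : Rabs (dx - (p * da + q * dy)) <= e1 * (Rabs da + m)).
  { eapply Rle_trans; [exact H1|]. apply Rmult_le_compat_l; lra. }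
  assert (L2 : p * Rabs da <= Rabs dx + Rabs q * Rabs dy + Rabs (dx - (p * da + q * dy))).
  { replace (p * Rabs da) with (Rabs (p * da)) by (rewrite Rabs_mult, (Rabs_pos_eq p); lra).
    replace (p * da) with (dx + - (q * dy) + - (dx - (p * da + q * dy))) at 1 by ring.
    eapply Rle_trans; [apply Rabs_triang|]. rewrite Rabs_Ropp.
    apply Rplus_le_compat_r. eapply Rle_trans; [apply Rabs_triang|].
    rewrite Rabs_Ropp, Rabs_mult. lra. }
  assert (L3 : Rabs q * Rabs dy <= Rabs q * m) by (apply Rmult_le_compat_l; lra).
  assert (Ee : e1 <= p / 2) by apply Rmin_l.
  assert (L4 : e1 * (Rabs da + m) <= p / 2 * (Rabs da + m)) by (apply Rmult_le_compat_r; lra).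
  assert (L5 : Rabs da <= K * m).
  { apply Rmult_le_reg_l with (p / 2); [lra|].
    replace (p / 2 * (K * m)) with ((1 + Rabs q + p / 2) * m) by (unfold K; field; lra). lra. }
  assert (Ee2 : e1 * (K + 1) <= eps * p).
  { apply Rle_trans with (eps * p / (K + 1) * (K + 1)).
    apply Rmult_le_compat_r; [lra|apply Rmin_r]. right; field; lra. }
  replace (da - (/ p * dx + - q / p * dy)) with (- ((dx - (p * da + q * dy)) / p))
    by (field; lra).
  rewrite Rabs_Ropp. unfold Rdiv. rewrite Rabs_mult, (Rabs_pos_eq (/ p)).
  2: left; apply Rinv_0_lt_compat; lra.
  apply Rmult_le_reg_r with p; [lra|]. rewrite Rmult_assoc, Rinv_l, Rmult_1_r by lra.
  eapply Rle_trans; [exact L1|].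
  apply Rle_trans with (e1 * ((K + 1) * m)); [apply Rmult_le_compat_l; lra|].
  rewrite <- Rmult_assoc. fold m. replace (eps * m * p) with (eps * p * m) by ring.
  apply Rmult_le_compat_r; lra.
Qed.

Lemma continuity_2d_differentiable (F : R -> R -> R) (x y p q : R) :
  differentiable_pt_lim F x y p q -> continuity_2d_pt F x y.
Proof.
  intros H. apply differentiable_continuity_pt. exists p, q. exact H.
Qed.

Lemma continuity_2d_pt_comp (F f g : R -> R -> R) (x y : R) :
  continuity_2d_pt F (f x y) (g x y) -> continuity_2d_pt f x y -> continuity_2d_pt g x y ->
  continuity_2d_pt (fun u v => F (f u v) (g u v)) x y.
Proof.
  intros HF Hf Hg eps. destruct (HF eps) as [d Hd].
  destruct (Hf d) as [d1 H1]. destruct (Hg d) as [d2 H2].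
  assert (Hm : 0 < Rmin d1 d2) by (apply Rmin_pos; apply cond_pos).
  exists (mkposreal _ Hm). simpl. intros u v Hu Hv.
  apply Hd; [apply H1|apply H2];
    (eapply Rlt_le_trans; [eassumption|]); (apply Rmin_l || apply Rmin_r).
Qed.

Lemma continuity_2d_pt_snd (f : R -> R) (x y : R) :
  continuous f y -> continuity_2d_pt (fun _ v => f v) x y.
Proof.
  intros H. apply (continuity_1d_2d_pt_comp f (fun _ v => v)).
  - apply continuity_pt_filterlim. exact H.
  - apply continuity_2d_pt_id2.
Qed.

Lemma jcont_of_continuity_2d (D : R -> Prop) (F : R -> R -> R) (x t : R) :
  continuity_2d_pt F x t -> jcont_at D F x t.
Proof.
  intros H eps Heps. destruct (H (mkposreal eps Heps)) as [d Hd].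
  exists d. split; [apply cond_pos|]. intros y s _ Hy Hs. apply (Hd y s Hy Hs).
Qed.

(** * Lagrangian flows and Eulerian solutions *)

(* [G] is the flow map, [U = u(G)] the velocity and [V = u_x(G)] the slope along it. *)
Record lagrangian_flow (lam : R) (D : R -> Prop) (G Ga U V Va Vt : R -> R -> R) : Prop := {
  flow_open : open D;
  flow_start : forall a, G a 0 = a;
  flow_zero : forall t, D t -> G 0 t = 0;
  flow_shift : forall a t, D t -> G (a + 1) t = G a t + 1;
  flow_U_periodic : forall a t, D t -> U (a + 1) t = U a t;
  flow_jacobian_pos : forall a t, D t -> 0 < Ga a t;
  flow_is_derive_G : forall a t, D t -> is_derive (fun z => G z t) a (Ga a t);
  flow_is_derive_G_time : forall a t, D t -> is_derive (fun s => G a s) t (U a t);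
  flow_is_derive_U : forall a t, D t -> is_derive (fun z => U z t) a (V a t * Ga a t);
  flow_is_derive_V : forall a t, D t -> is_derive (fun z => V z t) a (Va a t);
  flow_is_derive_V_time : forall a t, D t -> is_derive (fun s => V a s) t (Vt a t);
  flow_cont_Ga : forall a t, D t -> continuity_2d_pt Ga a t;
  flow_cont_U : forall a t, D t -> continuity_2d_pt U a t;
  flow_cont_Va : forall a t, D t -> continuity_2d_pt Va a t;
  flow_cont_Vt : forall a t, D t -> continuity_2d_pt Vt a t;
  flow_equation : forall a t, D t ->
    Vt a t - lam * (V a t)^2 = - (lam + 1) * RInt (fun b => (V b t)^2 * Ga b t) 0 1 }.

Arguments flow_open {lam D G Ga U V Va Vt}.
Arguments flow_start {lam D G Ga U V Va Vt}.
Arguments flow_zero {lam D G Ga U V Va Vt}.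
Arguments flow_shift {lam D G Ga U V Va Vt}.
Arguments flow_U_periodic {lam D G Ga U V Va Vt}.
Arguments flow_jacobian_pos {lam D G Ga U V Va Vt}.
Arguments flow_is_derive_G {lam D G Ga U V Va Vt}.
Arguments flow_is_derive_G_time {lam D G Ga U V Va Vt}.
Arguments flow_is_derive_U {lam D G Ga U V Va Vt}.
Arguments flow_is_derive_V {lam D G Ga U V Va Vt}.
Arguments flow_is_derive_V_time {lam D G Ga U V Va Vt}.
Arguments flow_cont_Ga {lam D G Ga U V Va Vt}.
Arguments flow_cont_U {lam D G Ga U V Va Vt}.
Arguments flow_cont_Va {lam D G Ga U V Va Vt}.
Arguments flow_cont_Vt {lam D G Ga U V Va Vt}.
Arguments flow_equation {lam D G Ga U V Va Vt}.

Lemma is_derive_continuity_pt (f : R -> R) (x l : R) : is_derive f x l -> continuity_pt f x.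
Proof.
  intros H. apply derivable_continuous_pt. exists l. apply is_derive_Reals. exact H.
Qed.

Lemma is_derive_pos_increasing (f df : R -> R) :
  (forall x, is_derive f x (df x)) -> (forall x, 0 < df x) ->
  forall x y, x < y -> f x < f y.
Proof.
  intros Hd Hp x y Hxy.
  destruct (MVT_gen f x y df) as [c [_ E]].
  - intros z _. apply Hd.
  - intros z _. eapply is_derive_continuity_pt. apply Hd.
  - assert (0 < df c * (y - x)) by (apply Rmult_lt_0_compat; [apply Hp|lra]). lra.
Qed.

(** Makes a continuous map of degree one unbounded on both sides, so that the intermediate value
    theorem gives surjectivity in [flow_inverse_r]. *)
Lemma shift_nat (g : R -> R) :
  g 0 = 0 -> (forall a, g (a + 1) = g a + 1) ->
  forall n, g (INR n) = INR n /\ g (- INR n) = - INR n.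
Proof.
  intros H0 H1. induction n as [|n [IH1 IH2]].
  - simpl. rewrite Ropp_0. auto.
  - rewrite S_INR. split.
    + rewrite H1. lra.
    + specialize (H1 (- (INR n + 1))). replace (- (INR n + 1) + 1) with (- INR n) in H1 by ring.
      lra.
Qed.

(** The inverse in the label at fixed time (back-to-labels map). Choice by [epsilon] keeps it a
    total function of two reals; it is meaningful only at times of the domain. *)
Definition flow_inverse (G : R -> R -> R) (x t : R) : R :=
  epsilon (inhabits 0) (fun a => G a t = x).

Lemma flow_differentiable_G {lam D G Ga U V Va Vt} :
  lagrangian_flow lam D G Ga U V Va Vt ->
  forall a t, D t -> differentiable_pt_lim G a t (Ga a t) (U a t).
Proof.
  intros F a t Ht. apply differentiable_of_partials.
  - destruct (open_interval_around D t (flow_open F) Ht) as [d Hd].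
    exists d. intros u v _ Hv. apply (flow_is_derive_G F). auto.
  - apply (flow_cont_Ga F); auto.
  - apply (flow_is_derive_G_time F); auto.
Qed.

Lemma flow_differentiable_V {lam D G Ga U V Va Vt} :
  lagrangian_flow lam D G Ga U V Va Vt ->
  forall a t, D t -> differentiable_pt_lim V a t (Va a t) (Vt a t).
Proof.
  intros F a t Ht. apply differentiable_of_partials.
  - destruct (open_interval_around D t (flow_open F) Ht) as [d Hd].
    exists d. intros u v _ Hv. apply (flow_is_derive_V F). auto.
  - apply (flow_cont_Va F); auto.
  - apply (flow_is_derive_V_time F); auto.
Qed.

Lemma flow_increasing {lam D G Ga U V Va Vt} :
  lagrangian_flow lam D G Ga U V Va Vt ->
  forall t a b, D t -> a < b -> G a t < G b t.
Proof.
  intros F t a b Ht. apply (is_derive_pos_increasing (fun z => G z t) (fun z => Ga z t)).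
  - intros x. apply (flow_is_derive_G F); auto.
  - intros x. apply (flow_jacobian_pos F); auto.
Qed.

Lemma flow_increasing_inv {lam D G Ga U V Va Vt} :
  lagrangian_flow lam D G Ga U V Va Vt ->
  forall t a b, D t -> G a t < G b t -> a < b.
Proof.
  intros F t a b Ht H. destruct (Rtotal_order a b) as [E|[E|E]]; [exact E| |].
  - subst. lra.
  - generalize (flow_increasing F t b a Ht E). lra.
Qed.

Lemma flow_inverse_r {lam D G Ga U V Va Vt} :
  lagrangian_flow lam D G Ga U V Va Vt ->
  forall x t, D t -> G (flow_inverse G x t) t = x.
Proof.
  intros F x t Ht. unfold flow_inverse. apply epsilon_spec.
  destruct (INR_unbounded (Rabs x)) as [n Hn].
  destruct (shift_nat (fun a => G a t) (flow_zero F t Ht)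
             (fun a => flow_shift F a t Ht) n) as [H1 H2].
  assert (Hx := Rle_abs x). assert (Hx' := Rle_abs (- x)). rewrite Rabs_Ropp in Hx'.
  destruct (IVT_gen (fun a => G a t) (- INR n) (INR n) x) as [a [_ Ha]].
  - intros a. eapply is_derive_continuity_pt. apply (flow_is_derive_G F); auto.
  - rewrite H1, H2, Rmin_left, Rmax_right by lra. lra.
  - exists a. exact Ha.
Qed.

Lemma flow_inverse_l {lam D G Ga U V Va Vt} :
  lagrangian_flow lam D G Ga U V Va Vt ->
  forall a t, D t -> flow_inverse G (G a t) t = a.
Proof.
  intros F a t Ht. assert (E := flow_inverse_r F (G a t) t Ht).
  set (b := flow_inverse G (G a t) t) in *.
  destruct (Rtotal_order b a) as [L|[L|L]]; auto;
    generalize (flow_increasing F t _ _ Ht L); lra.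
Qed.

(** By monotonicity in the label it suffices to follow the two labels [a - eps] and [a + eps]: their
    images bracket [x] with a gap of at least [2 m], which survives a move of less than [m] by these
    images and of less than [m] by [x]. *)
Lemma flow_inverse_continuous {lam D G Ga U V Va Vt} :
  lagrangian_flow lam D G Ga U V Va Vt ->
  forall x t, D t -> continuity_2d_pt (flow_inverse G) x t.
Proof.
  intros F x t Ht eps. assert (He := cond_pos eps).
  set (a := flow_inverse G x t).
  assert (Ea : G a t = x) by (apply (flow_inverse_r F); auto).
  assert (La : G (a - eps) t < x).
  { rewrite <- Ea. apply (flow_increasing F); auto. lra. }
  assert (Ra : x < G (a + eps) t).
  { rewrite <- Ea. apply (flow_increasing F); auto. lra. }
  assert (C : forall b, continuity_2d_pt G b t).
  { intros b. eapply continuity_2d_differentiable.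
    apply (flow_differentiable_G F); auto. }
  set (m := Rmin (x - G (a - eps) t) (G (a + eps) t - x) / 2).
  assert (Hm : 0 < m) by (unfold m; apply Rdiv_lt_0_compat; [apply Rmin_pos; lra|lra]).
  assert (Hm1 : 2 * m <= x - G (a - eps) t).
  { unfold m. generalize (Rmin_l (x - G (a - eps) t) (G (a + eps) t - x)). lra. }
  assert (Hm2 : 2 * m <= G (a + eps) t - x).
  { unfold m. generalize (Rmin_r (x - G (a - eps) t) (G (a + eps) t - x)). lra. }
  destruct (C (a - eps) (mkposreal m Hm)) as [d1 H1].
  destruct (C (a + eps) (mkposreal m Hm)) as [d2 H2].
  destruct (open_interval_around D t (flow_open F) Ht) as [d3 H3].
  assert (Hd : 0 < Rmin m (Rmin d1 (Rmin d2 d3))).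
  { repeat apply Rmin_pos; try apply cond_pos; auto. }
  exists (mkposreal _ Hd). simpl in *. intros u v Hu Hv.
  assert (Q1 := Rmin_l m (Rmin d1 (Rmin d2 d3))).
  assert (Q2 := Rmin_r m (Rmin d1 (Rmin d2 d3))).
  assert (Q3 := Rmin_l d1 (Rmin d2 d3)). assert (Q4 := Rmin_r d1 (Rmin d2 d3)).
  assert (Q5 := Rmin_l d2 d3). assert (Q6 := Rmin_r d2 d3).
  assert (Dv : D v) by (apply H3; lra).
  assert (Z : forall z, Rabs (z - z) < d1 /\ Rabs (z - z) < d2).
  { intros z. rewrite Rminus_diag, Rabs_R0. split; apply cond_pos. }
  assert (K1 : Rabs (G (a - eps) v - G (a - eps) t) < m) by (apply H1; [apply Z|lra]).
  assert (K2 : Rabs (G (a + eps) v - G (a + eps) t) < m) by (apply H2; [apply Z|lra]).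
  apply Rabs_def2 in K1. apply Rabs_def2 in K2.
  assert (K3 : Rabs (u - x) < m) by lra. apply Rabs_def2 in K3.
  assert (Eb := flow_inverse_r F u v Dv).
  assert (a - eps < flow_inverse G u v).
  { apply (flow_increasing_inv F v); auto. lra. }
  assert (flow_inverse G u v < a + eps).
  { apply (flow_increasing_inv F v); auto. lra. }
  apply Rabs_def1; lra.
Qed.

Lemma flow_inverse_differentiable {lam D G Ga U V Va Vt} :
  lagrangian_flow lam D G Ga U V Va Vt ->
  forall x t, D t ->
  differentiable_pt_lim (flow_inverse G) x t
    (/ Ga (flow_inverse G x t) t)
    (- U (flow_inverse G x t) t / Ga (flow_inverse G x t) t).
Proof.
  intros F x t Ht. apply differentiable_inverse with (G := G).
  - apply (flow_differentiable_G F); auto.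
  - apply (flow_jacobian_pos F); auto.
  - apply (flow_inverse_continuous F); auto.
  - destruct (open_interval_around D t (flow_open F) Ht) as [d Hd].
    exists d. intros u v _ Hv. apply (flow_inverse_r F); auto.
Qed.

Lemma flow_inverse_is_derive {lam D G Ga U V Va Vt} :
  lagrangian_flow lam D G Ga U V Va Vt ->
  forall x t, D t ->
  is_derive (fun y => flow_inverse G y t) x (/ Ga (flow_inverse G x t) t).
Proof.
  intros F x t Ht. apply is_derive_Reals.
  replace (/ Ga (flow_inverse G x t) t) with
    (/ Ga (flow_inverse G x t) t * 1 + - U (flow_inverse G x t) t / Ga (flow_inverse G x t) t * 0)
    by ring.
  apply (derivable_pt_lim_comp_2d (flow_inverse G) (fun y => y) (fun _ => t)).
  - apply (flow_inverse_differentiable F); auto.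
  - apply derivable_pt_lim_id.
  - apply derivable_pt_lim_const.
Qed.

Lemma is_derive_zero_constant (f : R -> R) (a b : R) :
  a <= b -> (forall x, a <= x <= b -> is_derive f x 0) -> f a = f b.
Proof.
  intros Hab H. destruct (MVT_gen f a b (fun _ => 0)) as [c [_ E]].
  - intros x. rewrite Rmin_left, Rmax_right by lra. intros Hx. apply H; lra.
  - intros x. rewrite Rmin_left, Rmax_right by lra. intros Hx.
    eapply is_derive_continuity_pt, H; lra.
  - lra.
Qed.

(* The label [flow_inverse G (gamma a t) t] is conserved along any characteristic,
   by the chain rule; this replaces a Gronwall argument. *)
Lemma flow_characteristic {lam D G Ga U V Va Vt} T :
  lagrangian_flow lam D G Ga U V Va Vt -> (forall t, in_time T t -> D t) ->
  forall gamma,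
  is_characteristic T (fun x t => U (flow_inverse G x t) t) gamma ->
  forall a t, in_time T t -> flow_inverse G (gamma a t) t = a.
Proof.
  intros F HT gamma Hg a t [Ht HtT]. destruct (Hg a) as [Ha0 [Hac Had]].
  assert (BT : forall s, s <= t -> before T s).
  { intros s Hs. destruct T as [T0|]; simpl in *; lra. }
  assert (D0 : D 0) by (apply HT; split; [lra|apply BT; lra]).
  assert (A0 : flow_inverse G a 0 = a).
  { rewrite <- (flow_start F a) at 1. apply (flow_inverse_l F); auto. }
  destruct (Req_dec t 0) as [E|E]; [subst t; rewrite Ha0; exact A0|].
  set (B := fun s => flow_inverse G (gamma a s) s).
  assert (HB : forall s, 0 < s <= t -> is_derive B s 0).
  { intros s Hs. assert (Ds : D s) by (apply HT; split; [lra|apply BT; lra]).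
    apply is_derive_Reals.
    assert (P := flow_jacobian_pos F (flow_inverse G (gamma a s) s) s Ds).
    set (al := flow_inverse G (gamma a s) s) in *.
    replace 0 with (/ Ga al s * U al s + - U al s / Ga al s * 1) by (field; lra).
    apply (derivable_pt_lim_comp_2d (flow_inverse G) (gamma a) (fun s => s)).
    - apply (flow_inverse_differentiable F); auto.
    - apply Had; [lra|apply BT; lra].
    - apply derivable_pt_lim_id. }
  (* The differential equation of a characteristic is available only for positive times. The label
     is thus constant on [(0, t]], and its value [a] is recovered by continuity at time [0], through
     a small [s]. *)
  apply cond_eq. intros eps Heps.
  destruct (flow_inverse_continuous F a 0 D0 (mkposreal eps Heps)) as [d Hd].
  simpl in Hd. destruct (Hac d (cond_pos d)) as [d' [Hd' Hac']].
  set (s := Rmin t (Rmin d d' / 2)).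
  assert (Pm : 0 < Rmin d d') by (apply Rmin_pos; [apply cond_pos|lra]).
  assert (Hs0 : 0 < s) by (unfold s; apply Rmin_pos; lra).
  assert (Hst : s <= t) by apply Rmin_l.
  assert (Hsd : s <= Rmin d d' / 2) by apply Rmin_r.
  assert (Hd1 := Rmin_l d d'). assert (Hd2 := Rmin_r d d').
  assert (EB : B s = B t).
  { apply is_derive_zero_constant; [lra|]. intros x Hx. apply HB; lra. }
  fold (B t). rewrite <- EB. rewrite A0 in Hd. apply Hd.
  - apply Hac'; [lra|apply BT; lra].
  - rewrite Rminus_0_r, Rabs_pos_eq; lra.
Qed.

Lemma flow_slope_is_derive {lam D G Ga U V Va Vt} :
  lagrangian_flow lam D G Ga U V Va Vt ->
  forall x t, D t ->
  is_derive (fun y => U (flow_inverse G y t) t) x (V (flow_inverse G x t) t).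
Proof.
  intros F x t Ht.
  assert (P := flow_jacobian_pos F (flow_inverse G x t) t Ht).
  replace (V (flow_inverse G x t) t) with
    (scal (/ Ga (flow_inverse G x t) t) (V (flow_inverse G x t) t * Ga (flow_inverse G x t) t)).
  2: { unfold scal; simpl; unfold mult; simpl. field. lra. }
  apply (is_derive_comp (fun z => U z t) (fun y => flow_inverse G y t)).
  - apply (flow_is_derive_U F); auto.
  - apply (flow_inverse_is_derive F); auto.
Qed.

(** Change of variables [y = G b t]; [flow_zero] and [flow_shift] show that [[0,1]] is carried onto
    itself. *)
Lemma flow_energy {lam D G Ga U V Va Vt} :
  lagrangian_flow lam D G Ga U V Va Vt ->
  forall t, D t ->
  is_RInt (fun y => (V (flow_inverse G y t) t)^2) 0 1
    (RInt (fun b => (V b t)^2 * Ga b t) 0 1).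
Proof.
  intros F t Ht.
  set (h := fun y => (V (flow_inverse G y t) t)^2).
  assert (Ch : forall y, continuous h y).
  { intros y. apply continuity_pt_filterlim. unfold h.
    apply (continuity_pt_comp (fun y => V (flow_inverse G y t) t) (fun z => z ^ 2)).
    - apply (continuity_pt_comp (fun y => flow_inverse G y t) (fun z => V z t)).
      + eapply is_derive_continuity_pt. apply (flow_inverse_is_derive F); auto.
      + eapply is_derive_continuity_pt. apply (flow_is_derive_V F); auto.
    - apply derivable_continuous_pt, derivable_pt_pow. }
  replace (RInt (fun b => (V b t)^2 * Ga b t) 0 1) with (RInt h 0 1).
  - apply (RInt_correct h). apply (ex_RInt_continuous h). intros z _. apply Ch.
  - assert (G1 : G 1 t = 1).
    { replace 1 with (0 + 1) at 1 by ring. rewrite (flow_shift F), (flow_zero F); auto; ring. }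
    assert (E : RInt (fun z => scal (Ga z t) (h (G z t))) 0 1 = RInt h (G 0 t) (G 1 t)).
    { apply (RInt_comp h (fun z => G z t) (fun z => Ga z t)).
      - intros x _. apply Ch.
      - intros x _. split; [apply (flow_is_derive_G F); auto|].
        apply (continuous_comp_2 (fun z : R => z) (fun _ => t) Ga x).
        + apply continuous_id.
        + apply continuous_const.
        + apply continuity_2d_pt_filterlim. apply (flow_cont_Ga F); auto. }
    rewrite (flow_zero F), G1 in E by auto. rewrite <- E.
    apply RInt_ext. intros z _. unfold h, scal; simpl; unfold mult; simpl.
    rewrite (flow_inverse_l F) by auto. ring.
Qed.

(** With [A] the inverse flow, [u = U(A)], [u_x = V(A)], [u_xx = Va/Ga] and [u_xt = Vt - Va U/Ga],
    so the transport term [u u_xx] cancels the last summand and the equation reduces to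
    [flow_equation]. The second conclusion is the bridge by which every asymptotic statement about
    [u_x] becomes one about [V]. *)
Lemma flow_solution {lam D G Ga U V Va Vt} T :
  lagrangian_flow lam D G Ga U V Va Vt -> (forall t, in_time T t -> D t) ->
  in_time T 0 ->
  exists u ux, is_solution lam (fun x => U x 0) T u ux /\
    forall gamma, is_characteristic T u gamma ->
    forall a t, in_time T t -> ux (gamma a t) t = V a t.
Proof.
  intros F HT H0. set (A := flow_inverse G).
  exists (fun x t => U (A x t) t), (fun x t => V (A x t) t). split.
  2: { intros gamma Hg a t Ht. unfold A. f_equal.
       apply (flow_characteristic T F); auto. }
  assert (CA : forall x t, D t -> continuity_2d_pt A x t)
    by (apply (flow_inverse_continuous F)).
  assert (CC : forall Fn x t, (forall a t, D t -> continuity_2d_pt Fn a t) -> D t ->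
            continuity_2d_pt (fun x t => Fn (A x t) t) x t).
  { intros Fn x t HF Ht. apply (continuity_2d_pt_comp Fn A (fun _ t => t)); auto.
    apply continuity_2d_pt_id2. }
  assert (CV : forall a t, D t -> continuity_2d_pt V a t).
  { intros a t Ht. eapply continuity_2d_differentiable.
    apply (flow_differentiable_V F); auto. }
  assert (HT' : forall t, 0 < t -> before T t -> D t).
  { intros t Ht1 Ht2. apply HT. split; [lra|auto]. }
  exists (fun x t => Va (A x t) t / Ga (A x t) t),
    (fun x t => Vt (A x t) t - Va (A x t) t * U (A x t) t / Ga (A x t) t).
  repeat split.
  - intros x. unfold A. f_equal. rewrite <- (flow_start F x) at 1.
    apply (flow_inverse_l F). auto.
  - intros x t Ht. rewrite <- (flow_U_periodic F (A x t) t) by auto. f_equal.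
    unfold A. rewrite <- (flow_inverse_r F x t) at 1 by auto.
    rewrite <- (flow_shift F) by auto. apply (flow_inverse_l F). auto.
  - intros x t Ht. apply is_derive_Reals. apply (flow_slope_is_derive F). auto.
  - intros x t Ht. apply jcont_of_continuity_2d. apply (CC U); auto. apply (flow_cont_U F).
  - intros x t Ht. apply jcont_of_continuity_2d. apply (CC V); auto.
  - intros x t H1 H2. apply is_derive_Reals.
    replace (Va (A x t) t / Ga (A x t) t) with (scal (/ Ga (A x t) t) (Va (A x t) t))
      by (unfold scal; simpl; unfold mult; simpl; unfold Rdiv; ring).
    apply (is_derive_comp (fun z => V z t) (fun y => A y t)).
    + apply (flow_is_derive_V F); auto.
    + apply (flow_inverse_is_derive F); auto.
  - intros x t H1 H2. assert (Dt : D t) by auto.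
    assert (P := flow_jacobian_pos F (A x t) t Dt).
    replace (Vt (A x t) t - Va (A x t) t * U (A x t) t / Ga (A x t) t) with
      (Va (A x t) t * (/ Ga (A x t) t * 0 + - U (A x t) t / Ga (A x t) t * 1) + Vt (A x t) t * 1)
      by (field; lra).
    apply (derivable_pt_lim_comp_2d V (fun s => A x s) (fun s => s)).
    + apply (flow_differentiable_V F); auto.
    + apply (derivable_pt_lim_comp_2d A (fun _ => x) (fun s => s)).
      * apply (flow_inverse_differentiable F); auto.
      * apply derivable_pt_lim_const.
      * apply derivable_pt_lim_id.
    + apply derivable_pt_lim_id.
  - apply jcont_of_continuity_2d.
    apply (continuity_2d_pt_mult (fun x t => Va (A x t) t) (fun x t => / Ga (A x t) t)).
    + apply (CC Va); auto. apply (flow_cont_Va F).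
    + apply (continuity_2d_pt_inv (fun x t => Ga (A x t) t)).
      * apply (CC Ga); auto. apply (flow_cont_Ga F).
      * apply Rgt_not_eq, (flow_jacobian_pos F); auto.
  - apply jcont_of_continuity_2d.
    apply (continuity_2d_pt_minus (fun x t => Vt (A x t) t)
             (fun x t => Va (A x t) t * U (A x t) t / Ga (A x t) t)).
    + apply (CC Vt); auto. apply (flow_cont_Vt F).
    + apply (continuity_2d_pt_mult (fun x t => Va (A x t) t * U (A x t) t)
               (fun x t => / Ga (A x t) t)).
      * apply (continuity_2d_pt_mult (fun x t => Va (A x t) t) (fun x t => U (A x t) t)).
        -- apply (CC Va); auto. apply (flow_cont_Va F).
        -- apply (CC U); auto. apply (flow_cont_U F).
      * apply (continuity_2d_pt_inv (fun x t => Ga (A x t) t)).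
        -- apply (CC Ga); auto. apply (flow_cont_Ga F).
        -- apply Rgt_not_eq, (flow_jacobian_pos F); auto.
  - intros t H1 H2. assert (Dt : D t) by auto.
    exists (RInt (fun b => (V b t)^2 * Ga b t) 0 1). split.
    + assert (E := flow_energy F t Dt). fold A in E.
      exists (ex_RInt_Reals_0 _ _ _ (ex_intro _ _ E)).
      rewrite <- RInt_Reals. apply is_RInt_unique. exact E.
    + intros x. rewrite <- (flow_equation F (A x t) t Dt).
      assert (P := flow_jacobian_pos F (A x t) t Dt). field. lra.
Qed.

Lemma continuity_2d_pt_swap (F : R -> R -> R) (x y : R) :
  continuity_2d_pt F x y -> continuity_2d_pt (fun u v => F v u) y x.
Proof.
  intros H eps. destruct (H eps) as [d Hd]. exists d. intros u v Hu Hv. apply Hd; auto.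
Qed.

Lemma continuity_2d_pt_slice (F : R -> R -> R) (x y : R) :
  continuity_2d_pt F x y -> continuous (fun z => F z y) x.
Proof.
  intros H. apply (continuous_comp_2 (fun z : R => z) (fun _ => y) F x).
  - apply continuous_id.
  - apply continuous_const.
  - apply continuity_2d_pt_filterlim. exact H.
Qed.

(** * Primitives and inverses with a parameter *)

Definition primitive (h : R -> R -> R) (a s : R) : R := RInt (fun b => h b s) 0 a.

Section Primitive.

Variables (S : R -> Prop) (h hs : R -> R -> R).
Hypothesis S_open : open S.
Hypothesis h_cont : forall x s, S s -> continuity_2d_pt h x s.
Hypothesis hs_cont : forall x s, S s -> continuity_2d_pt hs x s.
Hypothesis h_derive : forall x s, S s -> is_derive (fun z => h x z) s (hs x s).

Lemma ex_RInt_slice (a b s : R) : S s -> ex_RInt (fun x => h x s) a b.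
Proof.
  intros Hs. apply (ex_RInt_continuous (fun x => h x s)). intros z _.
  apply continuity_2d_pt_slice. auto.
Qed.

Lemma is_derive_primitive (a s : R) : S s -> is_derive (fun z => primitive h z s) a (h a s).
Proof.
  intros Hs. unfold primitive. apply (is_derive_RInt (fun x => h x s) _ 0).
  - exists posreal_one. intros y _. apply (RInt_correct (fun x => h x s)).
    apply ex_RInt_slice. exact Hs.
  - apply continuity_2d_pt_slice. auto.
Qed.

Lemma is_derive_primitive_param (a s : R) :
  S s -> is_derive (fun z => primitive h a z) s (primitive hs a s).
Proof.
  intros Hs. unfold primitive.
  replace (RInt (fun b => hs b s) 0 a) with
    (RInt (fun b => Derive (fun z => h b z) s) 0 a).
  2: { apply RInt_ext. intros x _. apply is_derive_unique. auto. }
  destruct (open_interval_around S s S_open Hs) as [d Hd].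
  apply (is_derive_RInt_param (fun z b => h b z) 0 a s).
  - exists d. intros y Hy t _. exists (hs t y). apply h_derive. apply Hd. exact Hy.
  - intros t _. apply (continuity_2d_pt_ext_loc (fun u v => hs v u)).
    + exists d. intros u v Hu _. symmetry. apply is_derive_unique. auto.
    + apply continuity_2d_pt_swap. auto.
  - exists d. intros y Hy. apply ex_RInt_slice. apply Hd. exact Hy.
Qed.

Lemma continuity_primitive (a s : R) : S s -> continuity_2d_pt (primitive h) a s.
Proof.
  intros Hs. eapply continuity_2d_differentiable.
  apply (differentiable_of_partials (primitive h) h).
  - destruct (open_interval_around S s S_open Hs) as [d Hd].
    exists d. intros u v _ Hv. apply is_derive_primitive. auto.
  - auto.
  - apply is_derive_primitive_param. exact Hs.
Qed.

End Primitive.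

Section Inverse1d.

Variables (S : R -> Prop) (f df : R -> R).
Hypothesis S_open : open S.
Hypothesis S_convex : forall x y z, S x -> S z -> x <= y <= z -> S y.
Hypothesis f_derive : forall x, S x -> is_derive f x (df x).
Hypothesis df_pos : forall x, S x -> 0 < df x.

Definition image_of (t : R) : Prop := exists s, S s /\ f s = t.
Definition inverse_of (t : R) : R := epsilon (inhabits 0) (fun s => S s /\ f s = t).

Lemma inverse_of_spec (t : R) : image_of t -> S (inverse_of t) /\ f (inverse_of t) = t.
Proof. intros H. unfold inverse_of. apply epsilon_spec. exact H. Qed.

Lemma increasing_on (x y : R) : S x -> S y -> x < y -> f x < f y.
Proof.
  intros Hx Hy Hxy.
  assert (HS : forall z, Rmin x y <= z <= Rmax x y -> S z).
  { intros z. rewrite Rmin_left, Rmax_right by lra. intros Hz. apply (S_convex x z y); auto. }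
  destruct (MVT_gen f x y df) as [c [Hc E]].
  - intros z Hz. apply f_derive, HS. lra.
  - intros z Hz. eapply is_derive_continuity_pt. apply f_derive, HS. lra.
  - assert (0 < df c * (y - x)) by (apply Rmult_lt_0_compat; [apply df_pos, HS; auto|lra]). lra.
Qed.

Lemma increasing_on_inv (x y : R) : S x -> S y -> f x < f y -> x < y.
Proof.
  intros Hx Hy H. destruct (Rtotal_order x y) as [E|[E|E]]; [exact E| |].
  - subst. lra.
  - generalize (increasing_on y x Hy Hx E). lra.
Qed.

Lemma inverse_of_image (s : R) : S s -> inverse_of (f s) = s.
Proof.
  intros Hs. destruct (inverse_of_spec (f s)) as [H1 H2]; [exists s; auto|].
  destruct (Rtotal_order (inverse_of (f s)) s) as [E|[E|E]]; auto;
    apply increasing_on in E; auto; lra.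
Qed.

Lemma image_of_between (x z t : R) : S x -> S z -> f x < t < f z -> image_of t.
Proof.
  intros Hx Hz Ht.
  assert (Hxz : x < z) by (apply increasing_on_inv; auto; lra).
  destruct (Ranalysis5.IVT_interv (fun y => f y - t) x z) as [y [Hy E]]; try lra.
  - intros y Hy. apply (continuity_pt_minus f (fun _ => t)).
    + eapply is_derive_continuity_pt. apply f_derive. apply (S_convex x y z); auto.
    + apply continuity_pt_const. intros u v. reflexivity.
  - exists y. split; [apply (S_convex x y z); auto|lra].
Qed.

Lemma inverse_of_mono (s t : R) : S s -> image_of t -> f s < t -> s < inverse_of t.
Proof.
  intros Hs Ht H. destruct (inverse_of_spec t Ht) as [H1 H2].
  apply increasing_on_inv; auto. lra.
Qed.

Lemma inverse_of_mono_r (s t : R) : S s -> image_of t -> t < f s -> inverse_of t < s.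
Proof.
  intros Hs Ht H. destruct (inverse_of_spec t Ht) as [H1 H2].
  apply increasing_on_inv; auto. lra.
Qed.

(** The same bracketing as for the flow: the images of [s - m] and [s + m] enclose [t], and the
    intermediate value theorem puts all nearby times in the image. *)
Lemma inverse_of_near (t : R) (eps : posreal) : image_of t ->
  exists d : posreal, forall r, Rabs (r - t) < d ->
    image_of r /\ Rabs (inverse_of r - inverse_of t) < eps.
Proof.
  intros Ht. destruct (inverse_of_spec t Ht) as [H1 H2]. set (s := inverse_of t) in *.
  destruct (open_interval_around S s S_open H1) as [d Hd].
  set (m := Rmin d eps / 2).
  assert (Pm : 0 < Rmin d eps) by (apply Rmin_pos; apply cond_pos).
  assert (Q1 := Rmin_l d eps). assert (Q2 := Rmin_r d eps).
  assert (Hm : 0 < m) by (unfold m; lra).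
  assert (Hmd : 2 * m <= d) by (unfold m; lra). assert (Hme : 2 * m <= eps) by (unfold m; lra).
  assert (Sl : S (s - m)) by (apply Hd; apply Rabs_def1; lra).
  assert (Sr : S (s + m)) by (apply Hd; apply Rabs_def1; lra).
  assert (Fl : f (s - m) < t) by (rewrite <- H2; apply increasing_on; auto; lra).
  assert (Fr : t < f (s + m)) by (rewrite <- H2; apply increasing_on; auto; lra).
  assert (Hp : 0 < Rmin (t - f (s - m)) (f (s + m) - t)) by (apply Rmin_pos; lra).
  exists (mkposreal _ Hp). simpl. intros r Hr.
  assert (Q3 := Rmin_l (t - f (s - m)) (f (s + m) - t)).
  assert (Q4 := Rmin_r (t - f (s - m)) (f (s + m) - t)).
  apply Rabs_def2 in Hr.
  assert (Ir : image_of r) by (apply (image_of_between (s - m) (s + m)); auto; lra).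
  split; auto.
  assert (s - m < inverse_of r) by (apply inverse_of_mono; auto; lra).
  assert (inverse_of r < s + m) by (apply inverse_of_mono_r; auto; lra).
  apply Rabs_def1; lra.
Qed.

Lemma open_image_of : open image_of.
Proof.
  intros t Ht. destruct (inverse_of_near t posreal_one Ht) as [d Hd].
  exists d. intros r Hr. apply Hd. exact Hr.
Qed.

(** An instance of [differentiable_inverse] in which nothing varies with the second variable, so
    that [q = 0]. *)
Lemma is_derive_inverse_of (t : R) :
  image_of t -> is_derive inverse_of t (/ df (inverse_of t)).
Proof.
  intros Ht. apply is_derive_Reals.
  apply (differentiable_pt_lim_proj1_1 inverse_of t 0).
  destruct (inverse_of_spec t Ht) as [H1 H2].
  replace 0 with (- 0 / df (inverse_of t)) at 2 by (field; apply Rgt_not_eq, df_pos, H1).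
  apply (differentiable_inverse (fun a _ => f a) (fun t _ => inverse_of t) t 0).
  - apply (differentiable_pt_lim_proj1_0 f). apply is_derive_Reals. auto.
  - auto.
  - intros eps. destruct (inverse_of_near t eps Ht) as [d Hd].
    exists d. intros u v Hu _. apply Hd. exact Hu.
  - destruct (inverse_of_near t posreal_one Ht) as [d Hd].
    exists d. intros u v Hu _. apply inverse_of_spec. apply Hd. exact Hu.
Qed.

End Inverse1d.

(** * The explicit flow *)

Definition cos2pi (x : R) : R := cos (2 * PI * x).
(** Two-sided around [0], so that time [0] is interior to the time domain and needs no one-sided
    analysis. For [lam = 0] it is the whole line. *)
Definition dom (lam s : R) : Prop := -1 < lam * s < 1.
Definition denom (lam x s : R) : R := 1 - lam * s * cos2pi x.
(** Solution of the unforced Riccati equation [f' = lam f^2] that starts from [cos2pi x], the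
    derivative of the initial velocity. *)
Definition slope (lam x s : R) : R := cos2pi x / denom lam x s.

(* Unnormalised jacobian: the solution of [w' = slope * w], [w = 1] at [s = 0]. *)
Definition weight (lam x s : R) : R :=
  if Req_EM_T lam 0 then exp (s * cos2pi x) else Rpower (denom lam x s) (- / lam).

Lemma cos2pi_bound x : -1 <= cos2pi x <= 1.
Proof. apply COS_bound. Qed.

Lemma cos2pi_periodic x : cos2pi (x + 1) = cos2pi x.
Proof. unfold cos2pi. rewrite <- (cos_period (2 * PI * x) 1). f_equal. simpl. ring. Qed.

Lemma open_dom lam : open (dom lam).
Proof.
  intros s [H1 H2].
  destruct (Req_dec lam 0) as [E|E].
  { exists posreal_one. intros y _. unfold dom. rewrite E. lra. }
  assert (Pl : 0 < Rabs lam) by (apply Rabs_pos_lt; auto).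
  assert (Hd : 0 < Rmin (1 - lam * s) (lam * s + 1) / Rabs lam).
  { apply Rdiv_lt_0_compat; auto. apply Rmin_pos; lra. }
  exists (mkposreal _ Hd). intros y Hy.
  assert (Hy' : Rabs (y - s) < Rmin (1 - lam * s) (lam * s + 1) / Rabs lam) by exact Hy.
  assert (K : Rabs (lam * y - lam * s) < Rmin (1 - lam * s) (lam * s + 1)).
  { rewrite <- Rmult_minus_distr_l, Rabs_mult, Rmult_comm.
    apply Rmult_lt_reg_r with (/ Rabs lam); [apply Rinv_0_lt_compat; auto|].
    rewrite Rmult_assoc, Rinv_r, Rmult_1_r by lra. exact Hy'. }
  assert (Q1 := Rmin_l (1 - lam * s) (lam * s + 1)).
  assert (Q2 := Rmin_r (1 - lam * s) (lam * s + 1)).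
  apply Rabs_def2 in K. split; lra.
Qed.

Lemma dom_convex lam x y z : dom lam x -> dom lam z -> x <= y <= z -> dom lam y.
Proof.
  unfold dom. intros Hx Hz Hy. destruct (Rle_dec 0 lam) as [P|P].
  - assert (lam * x <= lam * y) by (apply Rmult_le_compat_l; lra).
    assert (lam * y <= lam * z) by (apply Rmult_le_compat_l; lra). lra.
  - assert (- lam * x <= - lam * y) by (apply Rmult_le_compat_l; lra).
    assert (- lam * y <= - lam * z) by (apply Rmult_le_compat_l; lra). lra.
Qed.

Lemma dom_0 lam : dom lam 0.
Proof. unfold dom. rewrite Rmult_0_r. lra. Qed.

Lemma mul_cos_bound x m : -1 < m < 1 -> 1 - Rabs m <= 1 - m * cos2pi x.
Proof.
  intros Hm. assert (C := cos2pi_bound x).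
  assert (m * cos2pi x <= Rabs m).
  { eapply Rle_trans; [apply Rle_abs|]. rewrite Rabs_mult.
    rewrite <- (Rmult_1_r (Rabs m)) at 2. apply Rmult_le_compat_l; [apply Rabs_pos|].
    apply Rabs_le. lra. }
  lra.
Qed.

Lemma denom_pos lam x s : dom lam s -> 0 < denom lam x s.
Proof.
  intros H. unfold denom. assert (K := mul_cos_bound x _ H).
  assert (Rabs (lam * s) < 1) by (apply Rabs_def1; apply H). lra.
Qed.

Lemma weight_pos lam x s : 0 < weight lam x s.
Proof. unfold weight. destruct Req_EM_T; apply exp_pos. Qed.

Lemma weight_0 lam x : weight lam x 0 = 1.
Proof.
  unfold weight, denom. destruct Req_EM_T.
  - rewrite Rmult_0_l. apply exp_0.
  - rewrite Rmult_0_r, Rmult_0_l, Rminus_0_r. unfold Rpower. rewrite ln_1, Rmult_0_r. apply exp_0.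
Qed.

Lemma is_derive_slope lam x s : dom lam s ->
  is_derive (fun z => slope lam x z) s (lam * (slope lam x s)^2).
Proof.
  intros H. assert (P := denom_pos lam x s H). unfold slope, denom in *.
  auto_derive; [lra|]. field. lra.
Qed.

Lemma is_derive_weight lam x s : dom lam s ->
  is_derive (fun z => weight lam x z) s (slope lam x s * weight lam x s).
Proof.
  intros H. assert (P := denom_pos lam x s H). unfold weight, slope, denom, Rpower in *.
  destruct Req_EM_T as [E|E]; auto_derive; auto.
  - subst lam. rewrite !Rmult_0_l, Rminus_0_r. field.
  - change (1 + - (lam * s * cos2pi x)) with (1 - lam * s * cos2pi x).
    field. split; [lra|exact E].
Qed.

Lemma is_derive_slope_x lam x s : dom lam s ->
  is_derive (fun z => slope lam z s) x (- 2 * PI * sin (2 * PI * x) / (denom lam x s)^2).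
Proof.
  intros H. assert (P := denom_pos lam x s H). unfold slope, denom, cos2pi in *.
  auto_derive; [lra|]. field. lra.
Qed.

Lemma Derive_eq (f : R -> R) (x l : R) : is_derive f x l -> Derive f x = l.
Proof. apply is_derive_unique. Qed.

Lemma continuity_2d_fst (f : R -> R) (x y : R) :
  continuous f x -> continuity_2d_pt (fun u _ => f u) x y.
Proof.
  intros H. apply (continuity_1d_2d_pt_comp f (fun u _ => u)).
  - apply continuity_pt_filterlim. exact H.
  - apply continuity_2d_pt_id1.
Qed.

Lemma continuity_2d_cos x s : continuity_2d_pt (fun u _ => cos2pi u) x s.
Proof.
  apply continuity_2d_fst. apply (ex_derive_continuous cos2pi). unfold cos2pi. auto_derive. auto.
Qed.

Lemma continuity_2d_denom lam x s : continuity_2d_pt (denom lam) x s.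
Proof.
  unfold denom. apply (continuity_2d_pt_minus (fun _ _ => 1)); [apply continuity_2d_pt_const|].
  apply (continuity_2d_pt_mult (fun _ s => lam * s)); [|apply continuity_2d_cos].
  apply (continuity_2d_pt_mult (fun _ _ => lam) (fun _ s => s)).
  - apply continuity_2d_pt_const.
  - apply continuity_2d_pt_id2.
Qed.

Lemma continuity_2d_slope lam x s : dom lam s -> continuity_2d_pt (slope lam) x s.
Proof.
  intros H. apply (continuity_2d_pt_mult (fun u _ => cos2pi u) (fun u v => / denom lam u v)).
  - apply continuity_2d_cos.
  - apply continuity_2d_pt_inv; [apply continuity_2d_denom|].
    apply Rgt_not_eq, denom_pos. auto.
Qed.

Lemma continuity_2d_weight lam x s : dom lam s -> continuity_2d_pt (weight lam) x s.
Proof.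
  intros H. unfold weight. destruct (Req_EM_T lam 0) as [E|E].
  - apply (continuity_1d_2d_pt_comp exp (fun u v => v * cos2pi u)).
    + apply derivable_continuous_pt, derivable_pt_exp.
    + apply (continuity_2d_pt_mult (fun _ v => v) (fun u _ => cos2pi u)).
      * apply continuity_2d_pt_id2.
      * apply continuity_2d_cos.
  - apply (continuity_1d_2d_pt_comp (fun z => Rpower z (- / lam)) (denom lam)).
    + assert (P := denom_pos lam x s H). apply continuity_pt_filterlim.
      apply (ex_derive_continuous (fun z => Rpower z (- / lam))).
      unfold Rpower. auto_derive. exact P.
    + apply continuity_2d_denom.
Qed.

Lemma primitive_0 h s : primitive h 0 s = 0.
Proof. apply (RInt_point (V := R_CompleteNormedModule)). Qed.

(** By periodicity the difference of the two primitives has derivative zero in [a], so it equals its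
    value at [a = 0]. *)
Lemma primitive_shift (S : R -> Prop) (h : R -> R -> R) :
  (forall x s, S s -> continuity_2d_pt h x s) ->
  (forall x s, S s -> h (x + 1) s = h x s) ->
  forall a s, S s -> primitive h (a + 1) s = primitive h a s + primitive h 1 s.
Proof.
  intros Hc Hp a s Hs.
  assert (Hd : forall x, is_derive (fun x => primitive h (x + 1) s - primitive h x s) x 0).
  { intros x. replace 0 with (minus (scal 1 (h (x + 1) s)) (h x s)).
    2: { rewrite Hp by auto. unfold minus, plus, opp, scal; simpl; unfold mult; simpl. ring. }
    apply (is_derive_minus (fun x => primitive h (x + 1) s)).
    - apply (is_derive_comp (fun x => primitive h x s) (fun x => x + 1)).
      + apply (is_derive_primitive S); auto.
      + auto_derive; auto.
    - apply (is_derive_primitive S); auto. }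
  assert (E : primitive h (a + 1) s - primitive h a s = primitive h (0 + 1) s - primitive h 0 s).
  { destruct (Rle_dec 0 a) as [P|P].
    - symmetry. apply (is_derive_zero_constant (fun x => primitive h (x + 1) s - primitive h x s)); auto.
    - apply (is_derive_zero_constant (fun x => primitive h (x + 1) s - primitive h x s)); auto. lra. }
  rewrite primitive_0, Rplus_0_l in E. lra.
Qed.

(** * The normalised flow and its change of time, for fixed [lam] *)

Section Concrete.

Variable lam : R.

Let S := dom lam.
Let w := weight lam.

(** The three definitions are the successive derivatives of the weight in [s]: if [f] is the slope,
    then [(f^n w)' = (n lam + 1) f^(n+1) w]. The third one serves to make [mass2] continuous, as the
    continuity of [gradient_t] requires. *)
Definition fw (x s : R) : R := slope lam x s * weight lam x s.
Definition ffw (x s : R) : R := (lam + 1) * ((slope lam x s)^2 * weight lam x s).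
Definition fffw (x s : R) : R :=
  (lam + 1) * (2 * lam + 1) * ((slope lam x s)^3 * weight lam x s).

Lemma cont_fw x s : S s -> continuity_2d_pt fw x s.
Proof.
  intros H. apply continuity_2d_pt_mult; [apply continuity_2d_slope|apply continuity_2d_weight]; auto.
Qed.

Lemma cont_pow (F : R -> R -> R) n x s :
  continuity_2d_pt F x s -> continuity_2d_pt (fun u v => F u v ^ n) x s.
Proof.
  intros H. apply (continuity_1d_2d_pt_comp (fun z => z ^ n) F); auto.
  apply derivable_continuous_pt, derivable_pt_pow.
Qed.

Lemma cont_pow_weight k n x s :
  S s -> continuity_2d_pt (fun u v => k * ((slope lam u v)^n * weight lam u v)) x s.
Proof.
  intros H. apply (continuity_2d_pt_mult (fun _ _ => k)); [apply continuity_2d_pt_const|].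
  apply (continuity_2d_pt_mult (fun u v => slope lam u v ^ n)).
  - apply cont_pow. apply continuity_2d_slope. auto.
  - apply continuity_2d_weight. auto.
Qed.

Lemma is_derive_fw x s : S s -> is_derive (fun z => fw x z) s (ffw x s).
Proof.
  intros H. unfold fw, ffw.
  assert (D1 := is_derive_slope lam x s H). assert (D2 := is_derive_weight lam x s H).
  auto_derive.
  - split; [eexists; exact D1|]. split; [eexists; exact D2|auto].
  - rewrite (Derive_eq (fun z : R => slope lam x z) _ _ D1).
    rewrite (Derive_eq (fun z : R => weight lam x z) _ _ D2). ring.
Qed.

Lemma is_derive_ffw x s : S s -> is_derive (fun z => ffw x z) s (fffw x s).
Proof.
  intros H. unfold ffw, fffw.
  assert (D1 := is_derive_slope lam x s H). assert (D2 := is_derive_weight lam x s H).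
  auto_derive.
  - split; [eexists; exact D1|]. split; [eexists; exact D2|auto].
  - rewrite (Derive_eq (fun z : R => slope lam x z) _ _ D1).
    rewrite (Derive_eq (fun z : R => weight lam x z) _ _ D2). ring.
Qed.

Definition mass (s : R) : R := primitive w 1 s.
Definition mass1 (s : R) : R := primitive fw 1 s.
Definition mass2 (s : R) : R := primitive ffw 1 s.
(** This is [ds/dt]. The exponent is the one for which the products of slope and mean cancel in
    [V_t - lam V^2], leaving a quantity independent of the label. *)
Definition speed (s : R) : R := Rpower (mass s) (- 2 * lam).
Definition clock (s : R) : R := RInt (fun r => / speed r) 0 s.

Lemma mass_pos s : S s -> 0 < mass s.
Proof.
  intros H. rewrite <- (primitive_0 w s).
  apply (is_derive_pos_increasing (fun a => primitive w a s) (fun a => w a s)); try lra.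
  - intros x. apply (is_derive_primitive S); auto. intros; apply continuity_2d_weight; auto.
  - intros x. apply weight_pos.
Qed.

Lemma is_derive_W a s : S s -> is_derive (fun z => primitive w a z) s (primitive fw a s).
Proof.
  intros H. apply (is_derive_primitive_param S w fw); auto.
  - apply open_dom.
  - intros; apply continuity_2d_weight; auto.
  - intros; apply cont_fw; auto.
  - intros; apply is_derive_weight; auto.
Qed.

Lemma is_derive_X a s : S s -> is_derive (fun z => primitive fw a z) s (primitive ffw a s).
Proof.
  intros H. apply (is_derive_primitive_param S fw ffw); auto.
  - apply open_dom.
  - intros; apply cont_fw; auto.
  - intros; apply cont_pow_weight; auto.
  - intros; apply is_derive_fw; auto.
Qed.

Lemma is_derive_mass s : S s -> is_derive mass s (mass1 s).
Proof. apply (is_derive_W 1). Qed.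

Lemma is_derive_mass1 s : S s -> is_derive mass1 s (mass2 s).
Proof. apply (is_derive_X 1). Qed.

Lemma is_derive_mass2 s : S s -> is_derive mass2 s (primitive fffw 1 s).
Proof.
  intros H. apply (is_derive_primitive_param S ffw fffw); auto.
  - apply open_dom.
  - intros; apply cont_pow_weight; auto.
  - intros; apply cont_pow_weight; auto.
  - intros; apply is_derive_ffw; auto.
Qed.

Lemma cont_W a s : S s -> continuity_2d_pt (primitive w) a s.
Proof.
  intros H. apply (continuity_primitive S w fw); auto.
  - apply open_dom.
  - intros; apply continuity_2d_weight; auto.
  - intros; apply cont_fw; auto.
  - intros; apply is_derive_weight; auto.
Qed.

Lemma cont_X a s : S s -> continuity_2d_pt (primitive fw) a s.
Proof.
  intros H. apply (continuity_primitive S fw ffw); auto.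
  - apply open_dom.
  - intros; apply cont_fw; auto.
  - intros; apply cont_pow_weight; auto.
  - intros; apply is_derive_fw; auto.
Qed.

Lemma speed_pos s : 0 < speed s.
Proof. apply exp_pos. Qed.

Lemma is_derive_speed s : S s ->
  is_derive speed s (- 2 * lam * (mass1 s / mass s) * speed s).
Proof.
  intros H. assert (P := mass_pos s H). assert (D1 := is_derive_mass s H).
  unfold speed, Rpower. auto_derive.
  - split; [eexists; exact D1|]. split; auto.
  - rewrite (Derive_eq (fun z : R => mass z) _ _ D1). field. lra.
Qed.

Lemma is_derive_clock s : S s -> is_derive clock s (/ speed s).
Proof.
  intros H.
  assert (C : forall r, S r -> continuous (fun r => / speed r) r).
  { intros r Hr. apply (ex_derive_continuous (fun r => / speed r)).
    assert (P := speed_pos r). assert (D1 := is_derive_speed r Hr).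
    auto_derive. split; [eexists; exact D1|]. split; [lra|auto]. }
  apply (is_derive_RInt (fun r => / speed r) clock 0).
  - destruct (open_interval_around S s (open_dom lam) H) as [d Hd].
    exists d. intros y Hy. apply (RInt_correct (fun r => / speed r)).
    apply (ex_RInt_continuous (fun r => / speed r)). intros z Hz. apply C.
    assert (Sy : S y) by (apply Hd; exact Hy).
    unfold Rmin, Rmax in Hz. destruct (Rle_dec 0 y).
    + apply (dom_convex lam 0 z y); auto. apply dom_0.
    + apply (dom_convex lam y z 0); auto. apply dom_0.
  - apply C. exact H.
Qed.

Lemma clock_0 : clock 0 = 0.
Proof. apply (RInt_point (V := R_CompleteNormedModule)). Qed.

Definition mean (s : R) : R := mass1 s / mass s.
(** Division by the total mass makes the flow map of degree one, which is what periodicity of [u]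
    demands. *)
Definition position (a s : R) : R := primitive w a s / mass s.
Definition jacobian (a s : R) : R := weight lam a s / mass s.
(** The time derivative of [position], that is [speed] times its derivative in [s]. *)
Definition velocity (a s : R) : R :=
  speed s * (primitive fw a s / mass s - primitive w a s * mean s / mass s).
(** The logarithmic time derivative of [jacobian]: the weight contributes its slope and the
    normalisation the mean. *)
Definition gradient (a s : R) : R := speed s * (slope lam a s - mean s).
Definition gradient_a (a s : R) : R :=
  speed s * (- 2 * PI * sin (2 * PI * a) / (denom lam a s)^2).
Definition gradient_t (a s : R) : R :=
  speed s * speed s *
  (lam * (slope lam a s)^2 - 2 * lam * mean s * (slope lam a s - mean s)
   - (mass2 s / mass s - mean s ^ 2)).

Lemma is_derive_mean s : S s -> is_derive mean s (mass2 s / mass s - mean s ^ 2).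
Proof.
  intros H. assert (P := mass_pos s H).
  assert (D1 := is_derive_mass s H). assert (D2 := is_derive_mass1 s H).
  unfold mean. auto_derive.
  - split; [eexists; exact D2|]. split; [eexists; exact D1|]. split; [lra|auto].
  - rewrite (Derive_eq (fun z : R => mass z) _ _ D1), (Derive_eq (fun z : R => mass1 z) _ _ D2).
    field. lra.
Qed.

Lemma is_derive_position_a a s : S s -> is_derive (fun z => position z s) a (jacobian a s).
Proof.
  intros H. assert (P := mass_pos s H).
  assert (D1 : is_derive (fun z => primitive w z s) a (w a s)).
  { apply (is_derive_primitive S); auto. intros; apply continuity_2d_weight; auto. }
  unfold position, jacobian. auto_derive.
  - eexists; exact D1.
  - rewrite (Derive_eq (fun z : R => primitive w z s) _ _ D1). unfold w. field. lra.
Qed.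

Lemma is_derive_position_s a s :
  S s -> is_derive (fun z => position a z) s (velocity a s / speed s).
Proof.
  intros H. assert (P := mass_pos s H). assert (Q := speed_pos s).
  assert (D1 := is_derive_W a s H). assert (D2 := is_derive_mass s H).
  unfold position, velocity, mean. auto_derive.
  - split; [eexists; exact D1|]. split; [eexists; exact D2|]. split; [lra|auto].
  - rewrite (Derive_eq (fun z : R => primitive w a z) _ _ D1),
      (Derive_eq (fun z : R => mass z) _ _ D2). field. lra.
Qed.

Lemma is_derive_velocity_a a s :
  S s -> is_derive (fun z => velocity z s) a (gradient a s * jacobian a s).
Proof.
  intros H. assert (P := mass_pos s H).
  assert (D1 : is_derive (fun z => primitive w z s) a (w a s)).
  { apply (is_derive_primitive S); auto. intros; apply continuity_2d_weight; auto. }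
  assert (D2 : is_derive (fun z => primitive fw z s) a (fw a s)).
  { apply (is_derive_primitive S); auto. intros; apply cont_fw; auto. }
  unfold velocity, gradient, jacobian. auto_derive.
  - split; [eexists; exact D2|]. split; [eexists; exact D1|auto].
  - rewrite (Derive_eq (fun z : R => primitive w z s) _ _ D1),
      (Derive_eq (fun z : R => primitive fw z s) _ _ D2). unfold w, fw. field. lra.
Qed.

Lemma is_derive_gradient_a a s :
  S s -> is_derive (fun z => gradient z s) a (gradient_a a s).
Proof.
  intros H. assert (D1 := is_derive_slope_x lam a s H).
  unfold gradient, gradient_a. auto_derive.
  - eexists; exact D1.
  - rewrite (Derive_eq (fun z : R => slope lam z s) _ _ D1). ring.
Qed.

Lemma is_derive_gradient_s a s :
  S s -> is_derive (fun z => gradient a z) s (gradient_t a s / speed s).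
Proof.
  intros H. assert (P := mass_pos s H). assert (Q := speed_pos s).
  assert (D1 := is_derive_slope lam a s H). assert (D2 := is_derive_mean s H).
  assert (D3 := is_derive_speed s H).
  unfold gradient, gradient_t. auto_derive.
  - split; [eexists; exact D3|]. split; [eexists; exact D1|]. split; [eexists; exact D2|auto].
  - rewrite (Derive_eq (fun z : R => speed z) _ _ D3),
      (Derive_eq (fun z : R => slope lam a z) _ _ D1), (Derive_eq (fun z : R => mean z) _ _ D2).
    fold (mean s). field. lra.
Qed.

Lemma cont_snd (g : R -> R) (dg x s : R) :
  is_derive g s dg -> continuity_2d_pt (fun _ v => g v) x s.
Proof.
  intros H. apply continuity_2d_pt_snd. apply (ex_derive_continuous g). exists dg. exact H.
Qed.

Lemma cont_inv_mass x s : S s -> continuity_2d_pt (fun _ v => / mass v) x s.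
Proof.
  intros H. apply (continuity_2d_pt_inv (fun _ v => mass v)).
  - apply (cont_snd mass _ _ _ (is_derive_mass s H)).
  - apply Rgt_not_eq, mass_pos, H.
Qed.

Lemma cont_jacobian x s : S s -> continuity_2d_pt jacobian x s.
Proof.
  intros H. apply (continuity_2d_pt_mult (weight lam) (fun _ v => / mass v)).
  - apply continuity_2d_weight. auto.
  - apply cont_inv_mass. auto.
Qed.

Lemma cont_velocity x s : S s -> continuity_2d_pt velocity x s.
Proof.
  intros H. apply (continuity_2d_pt_mult (fun _ v => speed v)).
  - apply (cont_snd speed _ _ _ (is_derive_speed s H)).
  - apply continuity_2d_pt_minus.
    + apply (continuity_2d_pt_mult (primitive fw) (fun _ v => / mass v)).
      * apply cont_X; auto.
      * apply cont_inv_mass. auto.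
    + apply (continuity_2d_pt_mult (fun u v => primitive w u v * mean v) (fun _ v => / mass v)).
      * apply continuity_2d_pt_mult; [apply cont_W; auto|].
        apply (cont_snd mean _ _ _ (is_derive_mean s H)).
      * apply cont_inv_mass. auto.
Qed.

Lemma cont_gradient_a x s : S s -> continuity_2d_pt gradient_a x s.
Proof.
  intros H. apply (continuity_2d_pt_mult (fun _ v => speed v)).
  - apply (cont_snd speed _ _ _ (is_derive_speed s H)).
  - apply (continuity_2d_pt_mult (fun u _ => - 2 * PI * sin (2 * PI * u))
             (fun u v => / (denom lam u v) ^ 2)).
    + apply continuity_2d_fst.
      apply (ex_derive_continuous (fun u => - 2 * PI * sin (2 * PI * u))). auto_derive. auto.
    + apply (continuity_2d_pt_inv (fun u v => denom lam u v ^ 2)).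
      * apply cont_pow. apply continuity_2d_denom.
      * apply pow_nonzero, Rgt_not_eq, denom_pos, H.
Qed.

Lemma cont_gradient_t x s : S s -> continuity_2d_pt gradient_t x s.
Proof.
  intros H.
  assert (C1 := cont_snd speed _ x _ (is_derive_speed s H)).
  assert (C2 := cont_snd mean _ x _ (is_derive_mean s H)).
  assert (C3 := cont_snd mass2 _ x _ (is_derive_mass2 s H)).
  assert (C4 := continuity_2d_slope lam x s H).
  apply (continuity_2d_pt_mult (fun _ v => speed v * speed v)).
  - apply continuity_2d_pt_mult; auto.
  - apply continuity_2d_pt_minus; [apply continuity_2d_pt_minus|apply continuity_2d_pt_minus].
    + apply (continuity_2d_pt_mult (fun _ _ => lam) (fun u v => slope lam u v ^ 2)).
      * apply continuity_2d_pt_const.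
      * apply cont_pow. auto.
    + apply continuity_2d_pt_mult.
      * apply (continuity_2d_pt_mult (fun _ _ => 2 * lam) (fun _ v => mean v)); auto.
        apply continuity_2d_pt_const.
      * apply continuity_2d_pt_minus; auto.
    + apply (continuity_2d_pt_mult (fun _ v => mass2 v) (fun _ v => / mass v)); auto.
      apply cont_inv_mass. auto.
    + apply (cont_pow (fun _ v => mean v)). auto.
Qed.

(** Expand the square of [slope - mean] and integrate against [weight / mass]. The factor [lam + 1]
    stays on the left because [mass2] already carries it; nothing is divided by it, so [lam = -1] is
    covered. *)
Lemma gradient_energy s : S s ->
  (lam + 1) * RInt (fun b => gradient b s ^ 2 * jacobian b s) 0 1 =
  speed s * speed s * (mass2 s / mass s - (lam + 1) * mean s ^ 2).
Proof.
  intros H. assert (P := mass_pos s H).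
  assert (I0 : is_RInt (fun b => w b s) 0 1 (mass s)).
  { apply (RInt_correct (fun b => w b s)).
    apply (ex_RInt_slice S); auto. intros; apply continuity_2d_weight; auto. }
  assert (I1 : is_RInt (fun b => fw b s) 0 1 (mass1 s)).
  { apply (RInt_correct (fun b => fw b s)).
    apply (ex_RInt_slice S); auto. intros; apply cont_fw; auto. }
  assert (I2 : is_RInt (fun b => ffw b s) 0 1 (mass2 s)).
  { apply (RInt_correct (fun b => ffw b s)).
    apply (ex_RInt_slice S); auto. intros; apply cont_pow_weight; auto. }
  transitivity (RInt (fun b => scal (lam + 1) (gradient b s ^ 2 * jacobian b s)) 0 1).
  { symmetry. apply (RInt_scal (fun b => gradient b s ^ 2 * jacobian b s)).
    apply (ex_RInt_slice S (fun b s => gradient b s ^ 2 * jacobian b s)); auto.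
    intros x r Hr. apply continuity_2d_pt_mult; [|apply cont_jacobian; auto].
    apply cont_pow. apply (continuity_2d_pt_mult (fun _ v => speed v)).
    - apply (cont_snd speed _ _ _ (is_derive_speed r Hr)).
    - apply continuity_2d_pt_minus; [apply continuity_2d_slope; auto|].
      apply (cont_snd mean _ _ _ (is_derive_mean r Hr)). }
  apply is_RInt_unique.
  set (k := speed s * speed s / mass s).
  replace (speed s * speed s * (mass2 s / mass s - (lam + 1) * mean s ^ 2)) with
    (plus (scal k (mass2 s))
       (plus (scal (- 2 * (lam + 1) * mean s * k) (mass1 s))
             (scal ((lam + 1) * mean s ^ 2 * k) (mass s)))).
  2: { unfold plus, scal; simpl; unfold mult; simpl. unfold k, mean. field. lra. }
  apply (is_RInt_ext (fun b => plus (scal k (ffw b s))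
    (plus (scal (- 2 * (lam + 1) * mean s * k) (fw b s))
          (scal ((lam + 1) * mean s ^ 2 * k) (w b s))))).
  { intros x _. unfold plus, scal; simpl; unfold mult; simpl.
    unfold k, gradient, jacobian, ffw, fw, w. field. lra. }
  apply (is_RInt_plus (V := R_NormedModule)); [|apply (is_RInt_plus (V := R_NormedModule))];
    apply (is_RInt_scal (V := R_NormedModule)); [exact I2|exact I1|exact I0].
Qed.

Definition time_dom : R -> Prop := image_of S clock.
Definition param : R -> R := inverse_of S clock.

Lemma param_spec t : time_dom t -> S (param t) /\ clock (param t) = t.
Proof. apply inverse_of_spec. Qed.

Lemma is_derive_param t : time_dom t -> is_derive param t (speed (param t)).
Proof.
  intros H. rewrite <- (Rinv_inv (speed (param t))).
  apply (is_derive_inverse_of S clock (fun s => / speed s)); auto.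
  - apply open_dom.
  - apply dom_convex.
  - apply is_derive_clock.
  - intros x _. apply Rinv_0_lt_compat, speed_pos.
Qed.

Lemma param_clock s : S s -> param (clock s) = s.
Proof.
  apply (inverse_of_image S clock (fun s => / speed s)).
  - apply dom_convex.
  - apply is_derive_clock.
  - intros x _. apply Rinv_0_lt_compat, speed_pos.
Qed.

Lemma param_0 : param 0 = 0.
Proof. rewrite <- clock_0 at 1. apply param_clock, dom_0. Qed.

Lemma clock_increasing x y : S x -> S y -> x < y -> clock x < clock y.
Proof.
  apply (increasing_on S clock (fun s => / speed s)).
  - apply dom_convex.
  - apply is_derive_clock.
  - intros z _. apply Rinv_0_lt_compat, speed_pos.
Qed.

Lemma time_dom_between x z t : S x -> S z -> clock x < t < clock z -> time_dom t.
Proof.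
  apply (image_of_between S clock (fun s => / speed s)).
  - apply dom_convex.
  - apply is_derive_clock.
  - intros y _. apply Rinv_0_lt_compat, speed_pos.
Qed.

Lemma param_gt s t : S s -> time_dom t -> clock s < t -> s < param t.
Proof.
  apply (inverse_of_mono S clock (fun s => / speed s)).
  - apply dom_convex.
  - apply is_derive_clock.
  - intros y _. apply Rinv_0_lt_compat, speed_pos.
Qed.

Lemma cont_reparam (F : R -> R -> R) a t :
  (forall x s, S s -> continuity_2d_pt F x s) -> time_dom t ->
  continuity_2d_pt (fun a t => F a (param t)) a t.
Proof.
  intros HF Ht. apply (continuity_2d_pt_comp F (fun a _ => a) (fun _ t => param t)).
  - apply HF. apply param_spec. auto.
  - apply continuity_2d_pt_id1.
  - apply (cont_snd param _ _ _ (is_derive_param t Ht)).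
Qed.

Lemma is_derive_reparam (F : R -> R -> R) (dF : R) a t :
  is_derive (fun s => F a s) (param t) (dF / speed (param t)) -> time_dom t ->
  is_derive (fun t => F a (param t)) t dF.
Proof.
  intros HF Ht. assert (Q := speed_pos (param t)).
  replace dF with (scal (speed (param t)) (dF / speed (param t))).
  - apply (is_derive_comp (fun s => F a s) param); auto. apply is_derive_param. auto.
  - unfold scal; simpl; unfold mult; simpl. field. lra.
Qed.

Lemma concrete_flow :
  lagrangian_flow lam time_dom
    (fun a t => position a (param t)) (fun a t => jacobian a (param t))
    (fun a t => velocity a (param t)) (fun a t => gradient a (param t))
    (fun a t => gradient_a a (param t)) (fun a t => gradient_t a (param t)).
Proof.
  assert (HS : forall t, time_dom t -> S (param t)) by (intros t Ht; apply param_spec; auto).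
  assert (W1 : forall a s, S s -> primitive w (a + 1) s = primitive w a s + mass s).
  { apply (primitive_shift S).
    - intros; apply continuity_2d_weight; auto.
    - intros x s _. unfold w, weight, denom. rewrite cos2pi_periodic. reflexivity. }
  assert (X1 : forall a s, S s -> primitive fw (a + 1) s = primitive fw a s + mass1 s).
  { apply (primitive_shift S).
    - intros; apply cont_fw; auto.
    - intros x s _. unfold fw, slope, weight, denom. rewrite cos2pi_periodic. reflexivity. }
  split.
  - apply (open_image_of S clock (fun s => / speed s)).
    + apply open_dom.
    + apply dom_convex.
    + apply is_derive_clock.
    + intros x _. apply Rinv_0_lt_compat, speed_pos.
  - intros a. rewrite param_0. unfold position, mass, primitive.
    rewrite !(RInt_ext (fun b => w b 0) (fun _ => 1)) by (intros; apply weight_0).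
    rewrite !RInt_const. unfold scal; simpl; unfold mult; simpl. field.
  - intros t Ht. unfold position. rewrite primitive_0. unfold Rdiv. ring.
  - intros a t Ht. unfold position. rewrite W1 by auto.
    assert (P := mass_pos (param t) (HS t Ht)). field. lra.
  - intros a t Ht. unfold velocity, mean. rewrite W1, X1 by auto.
    assert (P := mass_pos (param t) (HS t Ht)). field. lra.
  - intros a t Ht. apply Rdiv_lt_0_compat; [apply weight_pos|apply mass_pos; auto].
  - intros a t Ht. apply is_derive_position_a. auto.
  - intros a t Ht. apply (is_derive_reparam position); auto. apply is_derive_position_s. auto.
  - intros a t Ht. apply is_derive_velocity_a. auto.
  - intros a t Ht. apply is_derive_gradient_a. auto.
  - intros a t Ht. apply (is_derive_reparam gradient); auto. apply is_derive_gradient_s. auto.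
  - intros a t Ht. apply (cont_reparam jacobian); auto. apply cont_jacobian.
  - intros a t Ht. apply (cont_reparam velocity); auto. apply cont_velocity.
  - intros a t Ht. apply (cont_reparam gradient_a); auto. apply cont_gradient_a.
  - intros a t Ht. apply (cont_reparam gradient_t); auto. apply cont_gradient_t.
  (* Once the energy is evaluated, the terms [2 lam slope mean] of [gradient_t] and of [lam V^2]
     cancel, and both sides are the same function of time. *)
  - intros a t Ht. rewrite Ropp_mult_distr_l_reverse, gradient_energy by auto.
    unfold gradient_t, gradient. ring.
Qed.

Lemma initial_velocity a : velocity a 0 = sin (2 * PI * a) / (2 * PI).
Proof.
  assert (Hp := PI_RGT_0).
  assert (M : mass 0 = 1).
  { unfold mass, primitive. rewrite (RInt_ext (fun b => w b 0) (fun _ => 1)) by (intros; apply weight_0).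
    rewrite RInt_const. unfold scal; simpl; unfold mult; simpl. ring. }
  assert (X0 : forall b, primitive fw b 0 = sin (2 * PI * b) / (2 * PI)).
  { intros b. apply is_RInt_unique. unfold fw.
    apply (is_RInt_ext (fun b => cos (2 * PI * b))).
    { intros x _. rewrite weight_0. unfold slope, denom. rewrite Rmult_0_r, Rmult_0_l, Rminus_0_r.
      unfold cos2pi, Rdiv. rewrite Rinv_1, !Rmult_1_r. reflexivity. }
    replace (sin (2 * PI * b) / (2 * PI)) with
      (minus (sin (2 * PI * b) / (2 * PI)) (sin (2 * PI * 0) / (2 * PI))).
    2: { rewrite Rmult_0_r, sin_0. unfold minus, plus, opp; simpl. field. lra. }
    apply (is_RInt_derive (fun b => sin (2 * PI * b) / (2 * PI)) (fun b => cos (2 * PI * b))).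
    - intros x _. auto_derive; auto. field. lra.
    - intros x _. apply (ex_derive_continuous (fun b => cos (2 * PI * b))). auto_derive. auto. }
  unfold velocity, mean, mass1. rewrite X0, (X0 1), M. unfold speed. rewrite M.
  rewrite Rmult_1_r, sin_2PI. unfold Rpower. rewrite ln_1, Rmult_0_r, exp_0. field. lra.
Qed.

End Concrete.

(** * Power integrals *)

(** This is [denom] at [mu = lam s]: the integrals then see [lam] only through the exponent, and
    signs of [lam] differ only by the sign of [mu]. *)
Definition base (mu x : R) : R := 1 - mu * cos2pi x.
Definition powint (q mu : R) : R := RInt (fun x => Rpower (base mu x) (- q)) 0 1.

Lemma base_bounds mu x : -1 < mu < 1 -> 0 < 1 - Rabs mu <= base mu x /\ base mu x <= 2.
Proof.
  intros H. assert (K := mul_cos_bound x mu H).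
  assert (K' := mul_cos_bound x (- mu)). rewrite Rabs_Ropp in K'.
  assert (Rabs mu < 1) by (apply Rabs_def1; lra).
  unfold base. split; [lra|].
  assert (1 - Rabs mu <= 1 - - mu * cos2pi x) by (apply K'; lra). lra.
Qed.

Lemma base_pos mu x : -1 < mu < 1 -> 0 < base mu x.
Proof. intros H. generalize (base_bounds mu x H). lra. Qed.

Lemma Rpower_pos x y : 0 < Rpower x y.
Proof. apply exp_pos. Qed.

Lemma is_derive_eq (f : R -> R) (x l l' : R) : is_derive f x l -> l = l' -> is_derive f x l'.
Proof. intros H E. rewrite <- E. exact H. Qed.

Lemma is_derive_base mu x : is_derive (base mu) x (mu * (2 * PI * sin (2 * PI * x))).
Proof. unfold base, cos2pi. auto_derive; auto. ring. Qed.

Lemma is_derive_Rpower_base mu p x : -1 < mu < 1 ->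
  is_derive (fun x => Rpower (base mu x) p) x
    (p * mu * (2 * PI * sin (2 * PI * x)) * Rpower (base mu x) (p - 1)).
Proof.
  intros H. assert (P := base_pos mu x H). assert (D := is_derive_base mu x).
  replace (p - 1) with (p + - (1)) by ring. rewrite Rpower_plus, Rpower_Ropp, Rpower_1 by auto.
  unfold Rpower. auto_derive.
  - split; [eexists; exact D|]. split; auto.
  - rewrite (Derive_eq (fun x : R => base mu x) _ _ D). field. lra.
Qed.

Lemma continuous_Rpower_base mu p x : -1 < mu < 1 -> continuous (fun x => Rpower (base mu x) p) x.
Proof.
  intros H. apply (ex_derive_continuous (fun x => Rpower (base mu x) p)).
  eexists. apply is_derive_Rpower_base. exact H.
Qed.

Lemma ex_RInt_Rpower_base mu p a b : -1 < mu < 1 -> ex_RInt (fun x => Rpower (base mu x) p) a b.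
Proof.
  intros H. apply (ex_RInt_continuous (fun x => Rpower (base mu x) p)). intros z _.
  apply continuous_Rpower_base. exact H.
Qed.

Lemma is_RInt_powint q mu : -1 < mu < 1 ->
  is_RInt (fun x => Rpower (base mu x) (- q)) 0 1 (powint q mu).
Proof.
  intros H. apply (RInt_correct (fun x => Rpower (base mu x) (- q))).
  apply ex_RInt_Rpower_base. exact H.
Qed.

Lemma powint_le_const q mu B : -1 < mu < 1 ->
  (forall x, Rpower (base mu x) (- q) <= B) -> powint q mu <= B.
Proof.
  intros H HB. replace B with (RInt (fun _ => B) 0 1).
  2: { rewrite RInt_const. unfold scal; simpl; unfold mult; simpl. ring. }
  apply RInt_le; try lra.
  - apply ex_RInt_Rpower_base. exact H.
  - apply ex_RInt_const.
  - intros x _. apply HB.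
Qed.

Lemma powint_ge_part q mu b (g : R -> R) : -1 < mu < 1 -> 0 <= b <= 1 -> ex_RInt g 0 b ->
  (forall x, 0 < x < b -> g x <= Rpower (base mu x) (- q)) -> RInt g 0 b <= powint q mu.
Proof.
  intros H Hb Hg HB. unfold powint.
  rewrite <- (RInt_Chasles (fun x => Rpower (base mu x) (- q)) 0 b 1).
  2,3: apply ex_RInt_Rpower_base; auto.
  assert (K1 : RInt g 0 b <= RInt (fun x => Rpower (base mu x) (- q)) 0 b).
  { apply RInt_le; try lra; auto. apply ex_RInt_Rpower_base; auto. }
  assert (K2 : 0 <= RInt (fun x => Rpower (base mu x) (- q)) b 1).
  { apply RInt_ge_0; try lra. apply ex_RInt_Rpower_base; auto.
    intros x _. left. apply Rpower_pos. }
  unfold plus; simpl. lra.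
Qed.

Lemma powint_ge_const q mu b m : -1 < mu < 1 -> 0 <= b <= 1 ->
  (forall x, 0 < x < b -> m <= Rpower (base mu x) (- q)) -> b * m <= powint q mu.
Proof.
  intros H Hb HB. replace (b * m) with (RInt (fun _ => m) 0 b).
  2: { rewrite RInt_const. unfold scal; simpl; unfold mult; simpl. ring. }
  apply powint_ge_part; auto. apply ex_RInt_const.
Qed.

Lemma powint_pos q mu : -1 < mu < 1 -> 0 < powint q mu.
Proof.
  intros H. apply RInt_gt_0; try lra.
  - intros x _. apply Rpower_pos.
  - intros x _. apply continuous_Rpower_base. exact H.
Qed.

Lemma is_derive_sin_mult (k : R) (g : R -> R) (x d : R) : is_derive g x d ->
  is_derive (fun x => k * (sin (2 * PI * x) * g x)) x
    (k * (2 * PI * cos (2 * PI * x) * g x + sin (2 * PI * x) * d)).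
Proof.
  intros D. auto_derive.
  - eexists; exact D.
  - rewrite (Derive_eq (fun x : R => g x) _ _ D). ring.
Qed.

(* The integral over a period of the derivative of [sin (2 PI x) * base^(-q)] vanishes. *)
Lemma powint_contiguous q mu : -1 < mu < 1 ->
  q * (1 - mu^2) * powint (q + 1) mu = (2 * q - 1) * powint q mu + (1 - q) * powint (q - 1) mu.
Proof.
  intros H. assert (Hpi := PI_RGT_0).
  (* The factor [mu / (2 PI)] allows the derivative to be written in powers of the base alone:
     [mu cos = 1 - base] and [mu^2 sin^2 = mu^2 - (1 - base)^2]. *)
  set (F := fun x => mu / (2 * PI) * (sin (2 * PI * x) * Rpower (base mu x) (- q))).
  set (dF := fun x => plus (scal (q * (1 - mu^2)) (Rpower (base mu x) (- (q + 1))))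
     (plus (scal (1 - 2 * q) (Rpower (base mu x) (- q)))
           (scal (q - 1) (Rpower (base mu x) (- (q - 1)))))).
  assert (D : forall x, is_derive F x (dF x)).
  { intros x. assert (P := base_pos mu x H).
    assert (D1 := is_derive_Rpower_base mu (- q) x H).
    apply (is_derive_eq F x (mu / (2 * PI) * (2 * PI * cos (2 * PI * x) * Rpower (base mu x) (- q)
      + sin (2 * PI * x) * (- q * mu * (2 * PI * sin (2 * PI * x)) * Rpower (base mu x) (- q - 1))))).
    - exact (is_derive_sin_mult _ _ _ _ D1).
    - unfold dF, plus, scal; simpl; unfold mult; simpl.
      replace (- q - 1) with (- (q + 1)) by ring.
      replace (- (q - 1)) with (- (q + 1) + (1 + 1)) by ring.
      replace (- q) with (- (q + 1) + 1) by ring.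
      rewrite !Rpower_plus, Rpower_1 by auto.
      set (Z := Rpower (base mu x) (- (q + 1))).
      assert (SC := sin2_cos2 (2 * PI * x)). unfold Rsqr in SC.
      unfold base, cos2pi in *.
      set (sn := sin (2 * PI * x)) in *. set (cs := cos (2 * PI * x)) in *.
      assert (E : sn * sn = 1 - cs * cs) by lra.
      transitivity (mu * Z * (cs * (1 - mu * cs)) - q * mu * mu * Z * (sn * sn)).
      + field. lra.
      + rewrite E. ring. }
  assert (I : is_RInt dF 0 1 (minus (F 1) (F 0))).
  { apply (is_RInt_derive F dF); intros x _; [apply D|].
    unfold dF. apply (continuous_plus (V := R_NormedModule));
      [|apply (continuous_plus (V := R_NormedModule))];
      apply (continuous_scal_r (V := R_NormedModule)); apply continuous_Rpower_base; exact H. }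
  assert (I' : is_RInt dF 0 1 (plus (scal (q * (1 - mu^2)) (powint (q + 1) mu))
     (plus (scal (1 - 2 * q) (powint q mu)) (scal (q - 1) (powint (q - 1) mu))))).
  { apply (is_RInt_plus (V := R_NormedModule)); [|apply (is_RInt_plus (V := R_NormedModule))];
    apply (is_RInt_scal (V := R_NormedModule)); apply is_RInt_powint; exact H. }
  assert (U : RInt (V := R_CompleteNormedModule) dF 0 1 = minus (F 1) (F 0))
    by (apply is_RInt_unique; exact I).
  apply (is_RInt_unique (V := R_CompleteNormedModule)) in I'. rewrite U in I'.
  unfold F, minus, plus, opp, scal in I'; simpl in I'; unfold mult in I'; simpl in I'.
  rewrite !Rmult_1_r, Rmult_0_r, sin_0, sin_2PI in I'. simpl in *. lra.
Qed.

Lemma is_RInt_cos2pi : is_RInt cos2pi 0 1 0.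
Proof.
  assert (Hpi := PI_RGT_0).
  replace 0 with (minus (sin (2 * PI * 1) / (2 * PI)) (sin (2 * PI * 0) / (2 * PI))) at 2.
  2: { rewrite Rmult_1_r, Rmult_0_r, sin_0, sin_2PI. unfold minus, plus, opp; simpl. field. lra. }
  apply (is_RInt_derive (fun b => sin (2 * PI * b) / (2 * PI)) cos2pi); intros x _.
  - unfold cos2pi. auto_derive; auto. field. lra.
  - apply (ex_derive_continuous cos2pi). unfold cos2pi. auto_derive. auto.
Qed.

(* Chebyshev: [1 - base] has mean zero and [base^(-q) - 1] has the sign of [q] times its sign. *)
Lemma powint_monotone q mu : -1 < mu < 1 -> 0 <= q * (powint q mu - powint (q - 1) mu).
Proof.
  intros H.
  assert (I : is_RInt (fun x => minus (scal q (minus (Rpower (base mu x) (- q))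
      (Rpower (base mu x) (- (q - 1))))) (scal (q * mu) (cos2pi x))) 0 1
      (minus (scal q (minus (powint q mu) (powint (q - 1) mu))) (scal (q * mu) 0))).
  { apply (is_RInt_minus (V := R_NormedModule)); apply (is_RInt_scal (V := R_NormedModule)).
    - apply (is_RInt_minus (V := R_NormedModule)); apply is_RInt_powint; auto.
    - apply is_RInt_cos2pi. }
  replace (q * (powint q mu - powint (q - 1) mu)) with
    (minus (scal q (minus (powint q mu) (powint (q - 1) mu))) (scal (q * mu) 0)).
  2: { unfold minus, plus, opp, scal; simpl; unfold mult; simpl. ring. }
  rewrite <- (is_RInt_unique _ _ _ _ I).
  apply RInt_ge_0; [lra|eexists; exact I|].
  intros x _. assert (P := base_pos mu x H).
  unfold minus, plus, opp, scal; simpl; unfold mult; simpl.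
  replace (- (q - 1)) with (- q + 1) by ring. rewrite Rpower_plus, Rpower_1 by auto.
  replace (q * mu * cos2pi x) with (q * (1 - base mu x)) by (unfold base; ring).
  set (B := base mu x) in *. set (Z := Rpower B (- q)).
  replace (q * (Z + - (Z * B)) + - (q * (1 - B))) with (q * ((1 - B) * (Z - 1))) by ring.
  assert (Z1 : Z = exp (- q * ln B)) by reflexivity.
  (* [1 + x <= exp x] gives [Z >= 1] as soon as [- q ln B >= 0]; for the other sign, monotonicity of
     [exp] is used. *)
  assert (E1 := exp_ineq1_le (- q * ln B)). rewrite <- Z1 in E1.
  destruct (Rtotal_order B 1) as [L|[L|L]].
  - assert (ln B < 0) by (rewrite <- ln_1; apply ln_increasing; lra).
    destruct (Rle_dec 0 q).
    + assert (0 <= - q * ln B) by nra. assert (0 <= (1 - B) * (Z - 1)) by nra. nra.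
    + assert (Z < 1). { rewrite Z1, <- exp_0. apply exp_increasing. nra. }
      assert ((1 - B) * (Z - 1) <= 0) by nra. nra.
  - rewrite L. replace (1 - 1) with 0 by ring. lra.
  - assert (0 < ln B) by (rewrite <- ln_1; apply ln_increasing; lra).
    destruct (Rle_dec 0 q).
    + assert (Z <= 1). { destruct (Req_dec q 0). rewrite Z1. subst q.
        rewrite Ropp_0, Rmult_0_l, exp_0. lra. left. rewrite Z1, <- exp_0. apply exp_increasing. nra. }
      assert (0 <= (1 - B) * (Z - 1)) by nra. nra.
    + assert (0 <= - q * ln B) by nra.
      assert ((1 - B) * (Z - 1) <= 0) by nra. nra.
Qed.

(** Multiplied by [q^2], the defect becomes, by the contiguous relation, [1 - q] times the
    nonnegative quantity of [powint_monotone]; this treats both signs of [q] at once. It controls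
    the mean at the extremal labels, for [lam > 1] and for [lam < 0] alike. *)
Lemma powint_ratio q mu : -1 < mu < 1 -> q < 1 -> q <> 0 ->
  (1 - mu^2) * powint (q + 1) mu <= powint q mu.
Proof.
  intros H Hq Hq0. assert (C := powint_contiguous q mu H). assert (M := powint_monotone q mu H).
  assert (E : q * q * (powint q mu - (1 - mu^2) * powint (q + 1) mu) =
    (1 - q) * (q * (powint q mu - powint (q - 1) mu))).
  { replace (q * q * (powint q mu - (1 - mu^2) * powint (q + 1) mu)) with
      (q * (q * powint q mu - q * (1 - mu^2) * powint (q + 1) mu)) by ring.
    rewrite C. ring. }
  assert (0 < q * q) by nra.
  assert (0 <= (1 - q) * (q * (powint q mu - powint (q - 1) mu))) by (apply Rmult_le_pos; lra).
  nra.
Qed.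

Lemma powint_nonpos_bound q mu : -1 < mu < 1 -> q <= 0 -> powint q mu <= Rpower 2 (- q).
Proof.
  intros H Hq. apply powint_le_const; auto. intros x.
  assert (K := base_bounds mu x H). apply Rle_Rpower_l; lra.
Qed.

(** Below [1/2] the coefficient [1 - 2q] is positive, so dropping the term in [powint (q + 1)] from
    the contiguous relation leaves [(1 - 2q) P_q <= (1 - q) P_(q-1)]. For [0 < q < 1/2] the index
    [q - 1] is negative and its integrand is at most a power of [2]. *)
Lemma powint_bounded q : q < 1 / 2 -> exists B, 0 < B /\ forall mu, -1 < mu < 1 -> powint q mu <= B.
Proof.
  intros Hq. destruct (Rle_dec q 0) as [L|L].
  { exists (Rpower 2 (- q)). split; [apply Rpower_pos|].
    intros mu H. apply powint_nonpos_bound; auto. }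
  exists ((1 - q) * Rpower 2 (- (q - 1)) / (1 - 2 * q)). split.
  { apply Rdiv_lt_0_compat; [|lra]. apply Rmult_lt_0_compat; [lra|apply Rpower_pos]. }
  intros mu H. assert (C := powint_contiguous q mu H).
  assert (B := powint_nonpos_bound (q - 1) mu H ltac:(lra)).
  assert (P := powint_pos (q + 1) mu H).
  assert (0 < 1 - mu^2) by nra.
  assert (0 <= q * (1 - mu^2) * powint (q + 1) mu).
  { apply Rmult_le_pos; [apply Rmult_le_pos|]; lra. }
  assert ((1 - q) * powint (q - 1) mu <= (1 - q) * Rpower 2 (- (q - 1)))
    by (apply Rmult_le_compat_l; lra).
  apply Rmult_le_reg_r with (1 - 2 * q); [lra|]. unfold Rdiv.
  rewrite Rmult_assoc, Rinv_l, Rmult_1_r by lra. lra.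
Qed.

(** * Real powers near zero, and lower bounds from the zero of the base *)

Lemma Rpower_le_base_neg x y p : 0 < x <= y -> p <= 0 -> Rpower y p <= Rpower x p.
Proof.
  intros Hx Hp. replace p with (- - p) by ring. rewrite !(Rpower_Ropp _ (- p)).
  apply Rinv_le_contravar; [apply Rpower_pos|]. apply Rle_Rpower_l; lra.
Qed.

Lemma Rpower_base_one p : Rpower 1 p = 1.
Proof. unfold Rpower. rewrite ln_1, Rmult_0_r. apply exp_0. Qed.

Lemma ln_nonpos x : 0 < x <= 1 -> ln x <= 0.
Proof.
  intros H. rewrite <- ln_1. destruct (Req_dec x 1) as [E|E]; [rewrite E; lra|].
  left. apply ln_increasing; lra.
Qed.

Lemma Rpower_le_exp_small x p q : 0 < x <= 1 -> q <= p -> Rpower x p <= Rpower x q.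
Proof.
  intros Hx Hpq. unfold Rpower. assert (L := ln_nonpos x Hx).
  destruct (Req_dec p q) as [E|E]; [subst; lra|].
  destruct (Req_dec (ln x) 0) as [E'|E']; [rewrite E', !Rmult_0_r; lra|].
  left. apply exp_increasing. nra.
Qed.

Lemma Rpower_small p eta : 0 < p -> 0 < eta ->
  exists d, 0 < d <= 1 /\ forall x, 0 < x < d -> Rpower x p < eta.
Proof.
  intros Hp He. exists (Rmin 1 (Rpower eta (/ p))).
  assert (P := Rpower_pos eta (/ p)).
  split.
  - split; [apply Rmin_pos; lra|apply Rmin_l].
  - intros x Hx. assert (Q := Rmin_r 1 (Rpower eta (/ p))).
    rewrite <- (Rpower_1 eta He) at 1. rewrite <- (Rinv_l p) by lra. rewrite <- Rpower_mult.
    apply Rlt_Rpower_l; lra.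
Qed.

Lemma Rpower_large p K : p < 0 ->
  exists d, 0 < d <= 1 /\ forall x, 0 < x < d -> K < Rpower x p.
Proof.
  intros Hp. destruct (Rpower_small (- p) (/ (Rabs K + 1))) as [d [Hd H]]; [lra| |].
  - apply Rinv_0_lt_compat. generalize (Rabs_pos K). lra.
  - exists d. split; auto. intros x Hx. specialize (H x Hx).
    rewrite Rpower_Ropp in H. apply Rinv_lt_cancel in H.
    + generalize (Rle_abs K). lra.
    + apply Rpower_pos.
Qed.

Lemma ln_large K : exists d, 0 < d <= 1 /\ forall x, 0 < x < d -> K < - ln x.
Proof.
  exists (Rmin 1 (exp (- K))). assert (P := exp_pos (- K)).
  split.
  - split; [apply Rmin_pos; lra|apply Rmin_l].
  - intros x Hx. assert (Q := Rmin_r 1 (exp (- K))).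
    assert (ln x < - K); [|lra]. rewrite <- (ln_exp (- K)). apply ln_increasing; lra.
Qed.

Lemma cos2pi_near_0 x : 0 <= x -> 1 - cos2pi x <= 2 * PI^2 * x^2.
Proof.
  intros Hx. assert (Hpi := PI_RGT_0). unfold cos2pi.
  replace (2 * PI * x) with (2 * (PI * x)) by ring. rewrite cos_2a_sin.
  assert (H0 : 0 <= PI * x) by (apply Rmult_le_pos; lra).
  assert (S1 : Rabs (sin (PI * x)) <= PI * x).
  { destruct (Req_dec x 0) as [E|E].
    - rewrite E, Rmult_0_r, sin_0, Rabs_R0. lra.
    - assert (0 < PI * x) by (apply Rmult_lt_0_compat; lra).
      apply Rabs_le. split.
      + destruct (Rle_dec (PI * x) PI) as [L|L].
        * generalize (sin_ge_0 (PI * x) H0 L). lra.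
        * generalize (SIN_bound (PI * x)). generalize PI2_1. unfold Rdiv. lra.
      + left. apply sin_lt_x. auto. }
  assert (S2 : sin (PI * x) * sin (PI * x) <= (PI * x) * (PI * x)).
  { apply Rabs_le_between in S1. nra. }
  nra.
Qed.

Lemma base_near_0 mu x : 0 <= mu < 1 -> 0 <= x -> base mu x <= 1 - mu + 2 * PI^2 * x^2.
Proof.
  intros Hm Hx. assert (C := cos2pi_near_0 x Hx). assert (C2 := cos2pi_bound x).
  unfold base. nra.
Qed.

(** On the window [[0, sqrt (1 - mu)]] the base is at most [(1 + 2 PI^2) (1 - mu)]; the width of the
    window supplies the [1/2] in the exponent. *)
Lemma powint_lower q mu : 0 <= q -> 0 <= mu < 1 ->
  Rpower (1 + 2 * PI^2) (- q) * Rpower (1 - mu) (1 / 2 - q) <= powint q mu.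
Proof.
  intros Hq Hm. assert (Hpi := PI_RGT_0).
  assert (HC : 0 < 1 + 2 * PI^2) by nra.
  assert (Hs := sqrt_lt_R0 (1 - mu) ltac:(lra)).
  assert (Hs2 := sqrt_sqrt (1 - mu) ltac:(lra)).
  replace (Rpower (1 + 2 * PI^2) (- q) * Rpower (1 - mu) (1 / 2 - q)) with
    (sqrt (1 - mu) * Rpower ((1 + 2 * PI^2) * (1 - mu)) (- q)).
  2: { rewrite <- (Rpower_mult_distr _ _ (- q)) by lra. rewrite <- Rpower_sqrt by lra.
       replace (1 / 2 - q) with (/ 2 + - q) by field. rewrite Rpower_plus. ring. }
  apply powint_ge_const; [lra| |].
  - split; [lra|]. nra.
  - intros x Hx. apply Rpower_le_base_neg; [|lra].
    split; [apply base_pos; lra|].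
    eapply Rle_trans; [apply base_near_0; lra|].
    assert (x^2 <= 1 - mu) by nra. assert (0 < PI^2) by nra. nra.
Qed.

Lemma cos2pi_nonneg x : 0 <= x <= 1 / 4 -> 0 <= cos2pi x.
Proof.
  intros Hx. assert (Hpi := PI_RGT_0). unfold cos2pi. apply cos_ge_0; nra.
Qed.

(** A shift by half a period changes the sign of the cosine. It brings negative [mu], the case
    [lam < 0], back to the lower bounds proved for [mu >= 0]. *)
Lemma powint_even q mu : -1 < mu < 1 -> powint q (- mu) = powint q mu.
Proof.
  intros H.
  (* Constant in its second argument, so that [primitive_shift] can express the invariance of the
     integral under translation. *)
  set (h := fun (x s : R) => Rpower (base mu x) (- q)).
  assert (C : forall x (s : R), True -> continuity_2d_pt h x s).
  { intros x s _. apply (continuity_2d_fst (fun x => Rpower (base mu x) (- q))). apply continuous_Rpower_base. auto. }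
  assert (Sh := primitive_shift (fun _ => True) h C).
  assert (E : primitive h (1 / 2 + 1) 0 = primitive h (1 / 2) 0 + primitive h 1 0).
  { apply Sh; auto. intros x s _. unfold h, base. rewrite cos2pi_periodic. reflexivity. }
  unfold primitive in E.
  transitivity (RInt (fun x => h x 0) (1 / 2) (1 / 2 + 1)).
  - replace (1 / 2) with (0 + 1 / 2) at 1 by lra. replace (1 / 2 + 1) with (1 + 1 / 2) by ring.
    rewrite <- (RInt_comp (fun x => h x 0) (fun x => x + 1 / 2) (fun _ => 1)).
    + apply RInt_ext. intros x _. unfold h, scal; simpl; unfold mult; simpl.
      rewrite Rmult_1_l. f_equal. unfold base.
      assert (cos2pi (x + 1 / 2) = - cos2pi x); [|rewrite H0; ring].
      unfold cos2pi. rewrite <- neg_cos. f_equal. field.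
    + intros x _. apply continuous_Rpower_base. auto.
    + intros x _. split; [auto_derive; auto|apply continuous_const].
  - assert (X : forall a b, ex_RInt (fun x => h x 0) a b)
      by (intros; apply ex_RInt_Rpower_base; auto).
    rewrite <- (RInt_Chasles (fun x => h x 0) 0 (1 / 2) (1 / 2 + 1)) in E by auto.
    unfold plus in E; simpl in E. unfold powint. change (fun x => Rpower (base mu x) (- q)) with (fun x => h x 0). lra.
Qed.

(** Covers the critical exponent, where a window bound gives no divergence. With [r = sqrt (1 - mu)]
    the base is at most [(r + 6 x)^2], as [2 PI^2 <= 36]; on the quarter period it is also at most
    [1], so the exponent may be lowered to [1/2]. The integral of [1 / (r + 6 x)] is at least
    [- ln r / 6], that is [- ln (1 - mu) / 12]. *)
Lemma powint_log_lower q mu : 1 / 2 <= q -> 0 <= mu < 1 -> - ln (1 - mu) / 12 <= powint q mu.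
Proof.
  intros Hq Hm. assert (Hpi := PI_RGT_0). assert (Hpi4 := PI_4).
  set (r := sqrt (1 - mu)).
  assert (Hr : 0 < r) by (apply sqrt_lt_R0; lra).
  assert (Hr2 : r * r = 1 - mu) by (apply sqrt_sqrt; lra).
  assert (Hln : ln (1 - mu) = 2 * ln r) by (rewrite <- Hr2, ln_mult by auto; ring).
  assert (I : is_RInt (fun x => / (r + 6 * x)) 0 (1 / 4)
     (minus (ln (r + 6 * (1 / 4)) / 6) (ln (r + 6 * 0) / 6))).
  { apply (is_RInt_derive (fun x => ln (r + 6 * x) / 6) (fun x => / (r + 6 * x)));
      intros x; rewrite Rmin_left, Rmax_right by lra; intros Hx.
    - auto_derive; [lra|]. field. lra.
    - apply (ex_derive_continuous (fun x => / (r + 6 * x))). auto_derive. lra. }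
  apply Rle_trans with (RInt (fun x => / (r + 6 * x)) 0 (1 / 4)).
  - rewrite (is_RInt_unique _ _ _ _ I). unfold minus, plus, opp; simpl.
    rewrite Rmult_0_r, Rplus_0_r, Hln.
    assert (0 <= ln (r + 6 * (1 / 4))).
    { left. rewrite <- ln_1. apply ln_increasing; lra. }
    lra.
  - apply powint_ge_part; [lra|lra|eexists; exact I|].
    intros x Hx. assert (P := base_pos mu x ltac:(lra)).
    assert (B1 : base mu x <= 1).
    { assert (C := cos2pi_nonneg x ltac:(lra)). unfold base. nra. }
    assert (B2 : base mu x <= (r + 6 * x) * (r + 6 * x)).
    { eapply Rle_trans; [apply base_near_0; lra|]. rewrite <- Hr2.
      assert (PI^2 <= 16) by nra. assert (0 < r * x) by nra. nra. }
    apply Rle_trans with (Rpower ((r + 6 * x) * (r + 6 * x)) (- (1 / 2))).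
    + rewrite Rpower_Ropp. replace (1 / 2) with (/ 2) by field.
      rewrite Rpower_sqrt by nra. rewrite sqrt_square by lra. lra.
    + eapply Rle_trans; [apply Rpower_le_base_neg; [split; [exact P|exact B2]|lra]|].
      apply Rpower_le_exp_small; lra.
Qed.

(** * Growth along the flow *)

Lemma mass_powint lam s : lam <> 0 -> mass lam s = powint (/ lam) (lam * s).
Proof.
  intros Hl. unfold mass, primitive, powint. apply RInt_ext. intros x _.
  unfold weight. destruct Req_EM_T; [contradiction|reflexivity].
Qed.

Lemma weight_base lam x s : lam <> 0 -> weight lam x s = Rpower (base (lam * s) x) (- / lam).
Proof. intros Hl. unfold weight. destruct Req_EM_T; [contradiction|reflexivity]. Qed.

Lemma fw_base lam x s : lam <> 0 -> dom lam s ->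
  fw lam x s = cos2pi x * Rpower (base (lam * s) x) (- (/ lam + 1)).
Proof.
  intros Hl H. assert (P := base_pos _ x H).
  unfold fw, slope. rewrite weight_base by auto. change (denom lam x s) with (base (lam * s) x).
  replace (- (/ lam + 1)) with (- / lam + - (1)) by ring.
  rewrite Rpower_plus, (Rpower_Ropp _ 1), Rpower_1 by auto. field. lra.
Qed.

Lemma is_RInt_mass1 lam s : dom lam s -> is_RInt (fun x => fw lam x s) 0 1 (mass1 lam s).
Proof.
  intros H. apply (RInt_correct (fun x => fw lam x s)).
  apply (ex_RInt_slice (dom lam)); auto. intros; apply cont_fw; auto.
Qed.

(** Multiplication by [mu = lam s] trades the cosine for [1 - base], which shifts the exponent. At
    [s = 0] the identity says nothing about [mass1]. *)
Lemma mass1_powint lam s : lam <> 0 -> dom lam s ->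
  lam * s * mass1 lam s = powint (/ lam + 1) (lam * s) - powint (/ lam) (lam * s).
Proof.
  intros Hl H.
  assert (I := is_RInt_scal (V := R_NormedModule) _ _ _ (lam * s) _ (is_RInt_mass1 lam s H)).
  assert (I' : is_RInt (fun x => minus (Rpower (base (lam * s) x) (- (/ lam + 1)))
       (Rpower (base (lam * s) x) (- / lam))) 0 1
      (minus (powint (/ lam + 1) (lam * s)) (powint (/ lam) (lam * s)))).
  { apply (is_RInt_minus (V := R_NormedModule)); apply is_RInt_powint; exact H. }
  apply (is_RInt_ext _ (fun x => scal (lam * s) (fw lam x s))) in I'.
  - apply (is_RInt_unique (V := R_CompleteNormedModule)) in I.
    apply (is_RInt_unique (V := R_CompleteNormedModule)) in I'.
    transitivity (RInt (V := R_CompleteNormedModule) (fun x => scal (lam * s) (fw lam x s)) 0 1).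
    + symmetry. exact I.
    + exact I'.
  - intros x _. rewrite fw_base by auto. assert (P := base_pos _ x H).
    unfold minus, plus, opp, scal; simpl; unfold mult; simpl.
    replace (- / lam) with (- (/ lam + 1) + 1) by ring. rewrite Rpower_plus, Rpower_1 by auto.
    unfold base. ring.
Qed.

Lemma gradient_powint lam a s : lam * s <> 0 -> dom lam s ->
  gradient lam a s = speed lam s / (lam * s) *
    (/ base (lam * s) a - powint (/ lam + 1) (lam * s) / powint (/ lam) (lam * s)).
Proof.
  intros Hm H. assert (Hl : lam <> 0) by (intros E; apply Hm; rewrite E; ring).
  assert (Hs : s <> 0) by (intros E; apply Hm; rewrite E; ring).
  assert (P := base_pos _ a H). assert (P2 := powint_pos (/ lam) _ H).
  assert (E := mass1_powint lam s Hl H).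
  unfold gradient, mean, slope. rewrite mass_powint by auto.
  change (denom lam a s) with (base (lam * s) a).
  replace (cos2pi a) with ((1 - base (lam * s) a) / (lam * s)) by (unfold base; field; split; auto).
  replace (mass1 lam s) with
    ((powint (/ lam + 1) (lam * s) - powint (/ lam) (lam * s)) / (lam * s))
    by (rewrite <- E; field; split; auto).
  set (mu := lam * s) in *. field. lra.
Qed.

Lemma mass_lower_pos lam s : 0 < lam -> dom lam s -> Rpower 2 (- / lam) <= mass lam s.
Proof.
  intros Hl H. rewrite mass_powint by lra. rewrite <- (Rmult_1_l (Rpower 2 _)).
  assert (0 < / lam) by (apply Rinv_0_lt_compat; lra).
  apply powint_ge_const; [exact H|lra|]. intros x _.
  assert (B := base_bounds (lam * s) x H). apply Rpower_le_base_neg; lra.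
Qed.

Lemma mass_upper_neg lam s : lam < 0 -> dom lam s -> mass lam s <= Rpower 2 (- / lam).
Proof.
  intros Hl H. rewrite mass_powint by lra.
  assert (/ lam < 0) by (apply Rinv_lt_0_compat; lra).
  apply powint_nonpos_bound; [exact H|lra].
Qed.

(** For [mu <= 0] the base is at least [1] on [[0, 1/4]], where the cosine is nonnegative, and the
    exponent [- / lam] is positive. *)
Lemma mass_lower_neg lam s : lam < 0 -> 0 <= s -> dom lam s -> 1 / 4 <= mass lam s.
Proof.
  intros Hl Hs H. rewrite mass_powint by lra. rewrite <- (Rmult_1_r (1 / 4)).
  assert (Hi : / lam < 0) by (apply Rinv_lt_0_compat; lra).
  apply powint_ge_const; [exact H|lra|]. intros x Hx.
  assert (C := cos2pi_nonneg x ltac:(lra)).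
  rewrite <- (Rpower_base_one (- / lam)). apply Rle_Rpower_l; [lra|].
  split; [lra|]. unfold base. assert (0 <= - (lam * s)) by nra. nra.
Qed.

(** The bound [2^(-1/lam)] on the mass is from below for [lam > 0] and from above for [lam < 0]; the
    power [-2 lam] changes direction accordingly and yields [4] in both cases. *)
Lemma speed_upper lam s : lam <> 0 -> dom lam s -> speed lam s <= 4.
Proof.
  intros Hl H.
  assert (E : Rpower (Rpower 2 (- / lam)) (- 2 * lam) = 4).
  { rewrite Rpower_mult. replace (- / lam * (-2 * lam)) with (1 + 1) by (field; auto).
    rewrite Rpower_plus, Rpower_1; lra. }
  rewrite <- E. unfold speed. assert (P := mass_pos lam s H).
  destruct (Rtotal_order lam 0) as [L|[L|L]]; [|contradiction|].
  - apply Rle_Rpower_l; [lra|]. split; auto. apply mass_upper_neg; auto.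
  - apply Rpower_le_base_neg; [|lra]. split; [apply Rpower_pos|apply mass_lower_pos; auto].
Qed.

Lemma speed_lower_neg lam s : lam < 0 -> 0 <= s -> dom lam s ->
  Rpower (1 / 4) (- 2 * lam) <= speed lam s.
Proof.
  intros Hl Hs H. unfold speed. apply Rle_Rpower_l; [lra|].
  split; [lra|]. apply mass_lower_neg; auto.
Qed.

(** [powint_lower] raised to the power [-2 lam]. An exponent [2 - lam >= 1] makes the clock diverge;
    [2 - lam > 1] moreover outweighs the growth [1 / (1 - mu)] of the slope. *)
Lemma speed_upper_pos lam s : 0 < lam -> 0 <= s -> dom lam s ->
  speed lam s <= (1 + 2 * PI^2)^2 * Rpower (1 - lam * s) (2 - lam).
Proof.
  intros Hl Hs H. assert (Hi : 0 < / lam) by (apply Rinv_0_lt_compat; lra).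
  assert (Hm : 0 <= lam * s) by (apply Rmult_le_pos; lra).
  destruct H as [H1 H2].
  assert (Hpi := PI_RGT_0). assert (HC : 0 < 1 + 2 * PI^2) by nra.
  set (C := 1 + 2 * PI^2) in *.
  assert (L := powint_lower (/ lam) (lam * s) ltac:(lra) ltac:(lra)). fold C in L.
  replace (C^2 * Rpower (1 - lam * s) (2 - lam)) with
    (Rpower (Rpower C (- / lam) * Rpower (1 - lam * s) (1 / 2 - / lam)) (- 2 * lam)).
  2: { rewrite <- Rpower_mult_distr by apply Rpower_pos. rewrite !Rpower_mult.
       replace (- / lam * (-2 * lam)) with (1 + 1) by (field; lra).
       rewrite (Rpower_plus 1 1 C), Rpower_1 by auto.
       replace ((1 / 2 - / lam) * (-2 * lam)) with (2 - lam) by (field; lra). ring. }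
  unfold speed. rewrite mass_powint by lra. apply Rpower_le_base_neg; [|lra].
  split; [|exact L]. apply Rmult_lt_0_compat; apply Rpower_pos.
Qed.

Lemma derive_le_increment (f g df dg : R -> R) (a b : R) : a <= b ->
  (forall x, a <= x <= b -> is_derive f x (df x)) ->
  (forall x, a <= x <= b -> is_derive g x (dg x)) ->
  (forall x, a <= x <= b -> df x <= dg x) -> f b - f a <= g b - g a.
Proof.
  intros Hab Hf Hg Hd.
  assert (Hgf : forall x, a <= x <= b -> is_derive (fun x => g x - f x) x (dg x - df x)).
  { intros x Hx. apply (is_derive_minus (V := R_NormedModule) g f); auto. }
  destruct (MVT_gen (fun x => g x - f x) a b (fun x => dg x - df x)) as [c [Hc E]];
    try rewrite Rmin_left, Rmax_right in * by lra.
  - intros x Hx. apply Hgf. lra.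
  - intros x Hx. eapply is_derive_continuity_pt. apply Hgf. lra.
  - assert (0 <= (dg c - df c) * (b - a)).
    { apply Rmult_le_pos; [|lra]. generalize (Hd c Hc). lra. }
    lra.
Qed.

Lemma dom_below lam r s : dom lam s -> 0 <= r <= s -> dom lam r.
Proof. intros H Hr. apply (dom_convex lam 0 r s); auto. apply dom_0. Qed.

(** For [lam <= 1] the clock grows at least as fast as the primitive of [1 / (C^2 (1 - lam r))], a
    logarithm. *)
Lemma clock_unbounded lam K : 0 < lam <= 1 -> exists s, 0 <= s /\ dom lam s /\ K < clock lam s.
Proof.
  intros Hl. assert (Hpi := PI_RGT_0). assert (HC : 0 < 1 + 2 * PI^2) by nra.
  set (C := 1 + 2 * PI^2) in *.
  assert (HC2 : 0 < C^2) by nra.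
  set (k := Rabs K + 1). assert (Hk : 0 < k) by (unfold k; generalize (Rabs_pos K); lra).
  (* Chosen so that this logarithmic minorant equals exactly [k > K] at the parameter where
     [1 - lam s = e]. *)
  set (e := exp (- (lam * C^2 * k))).
  assert (He : 0 < e < 1).
  { unfold e. split; [apply exp_pos|]. rewrite <- exp_0. apply exp_increasing.
    assert (0 < lam * C^2 * k) by (repeat apply Rmult_lt_0_compat; lra). lra. }
  set (s := (1 - e) / lam).
  assert (Els : lam * s = 1 - e) by (unfold s; field; lra).
  assert (Hs : 0 <= s) by (unfold s; apply Rmult_le_pos; [lra|left; apply Rinv_0_lt_compat; lra]).
  assert (Hd : dom lam s) by (unfold dom; lra).
  exists s. split; auto. split; auto.
  assert (B := derive_le_increment (fun r => - ln (1 - lam * r) / (lam * C^2)) (clock lam)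
    (fun r => / (C^2 * (1 - lam * r))) (fun r => / speed lam r) 0 s Hs).
  rewrite clock_0, Rmult_0_r, Rminus_0_r, ln_1, Els in B.
  replace (1 - (1 - e)) with e in B by ring. unfold e in B at 1. rewrite ln_exp in B.
  replace (- - (lam * C^2 * k) / (lam * C^2)) with k in B by (field; lra).
  replace (- 0 / (lam * C^2)) with 0 in B by (field; lra).
  assert (Kk : K < k) by (unfold k; generalize (Rle_abs K); lra).
  enough (k - 0 <= clock lam s - 0) by lra.
  apply B.
  - intros x Hx. assert (D := dom_below lam x s Hd Hx). destruct D as [D1 D2].
    auto_derive; [lra|]. field. lra.
  - intros x Hx. apply is_derive_clock. apply (dom_below lam x s Hd Hx).
  - intros x Hx. assert (D := dom_below lam x s Hd Hx).
    apply Rinv_le_contravar; [apply speed_pos|].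
    eapply Rle_trans; [apply speed_upper_pos; auto; lra|].
    fold C. apply Rmult_le_compat_l; [lra|]. destruct D as [D1 D2].
    rewrite <- (Rpower_1 (1 - lam * x)) at 2 by lra.
    apply Rpower_le_exp_small; [|lra].
    assert (0 <= lam * x) by (apply Rmult_le_pos; lra). lra.
Qed.

(* The exponent [th] is chosen small enough for the clock to stay bounded and for
   [powint (q + 1) / powint q] to dominate every [/ base] off the maxima. *)
Lemma powint_upper lam : 1 < lam ->
  exists th B, 0 < th /\ 2 * lam * th < 1 /\ th * (1 + 2 * lam) < / lam + 1 / 2 /\ 0 < B /\
    forall mu, 0 <= mu < 1 -> powint (/ lam) mu <= B * Rpower (1 - mu) (- th).
Proof.
  intros Hl. set (q := / lam).
  assert (Hq : 0 < q < 1).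
  { unfold q. split; [apply Rinv_0_lt_compat; lra|]. rewrite <- Rinv_1. apply Rinv_lt_contravar; lra. }
  assert (Elam : lam * q = 1) by (unfold q; field; lra).
  (* The first condition puts [q - th] below the critical exponent; the second is the required
     inequality multiplied by [q]. They are compatible because [(q - 1/2) (q + 2) < q (q + 1/2)]
     amounts to [q < 1], that is [lam > 1]. *)
  assert (T : exists th, 0 < th /\ q - 1 / 2 < th /\ th * (q + 2) < q * (q + 1 / 2)).
  { set (M := q * (q + 1 / 2) / (q + 2)).
    assert (EM : M * (q + 2) = q * (q + 1 / 2)) by (unfold M; field; lra).
    assert (M0 : 0 < M) by (unfold M; apply Rdiv_lt_0_compat; [apply Rmult_lt_0_compat; lra|lra]).
    assert (M1 : q - 1 / 2 < M).
    { apply Rmult_lt_reg_r with (q + 2); [lra|]. rewrite EM. nra. }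
    exists ((Rmax 0 (q - 1 / 2) + M) / 2).
    assert (R1 := Rmax_l 0 (q - 1 / 2)). assert (R2 := Rmax_r 0 (q - 1 / 2)).
    assert (R3 : Rmax 0 (q - 1 / 2) < M) by (apply Rmax_lub_lt; lra).
    split; [lra|]. split; [lra|]. rewrite <- EM. apply Rmult_lt_compat_r; lra. }
  destruct T as [th [T1 [T2 T3]]].
  destruct (powint_bounded (q - th) ltac:(lra)) as [B [HB HP]].
  exists th, B. split; auto.
  assert (T4 : th < q / 2) by nra.
  split. { replace (2 * lam * th) with (2 * th * lam) by ring. nra. }
  split.
  { replace (th * (1 + 2 * lam)) with (th * (q + 2) * lam) by (replace (th * (q + 2) * lam)
      with (th * (lam * q + 2 * lam)) by ring; rewrite Elam; ring).
    replace (q + 1 / 2) with (q * (q + 1 / 2) * lam)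
      by (replace (q * (q + 1 / 2) * lam) with ((lam * q) * (q + 1 / 2)) by ring; rewrite Elam; ring).
    apply Rmult_lt_compat_r; lra. }
  split; auto. intros mu Hm.
  assert (Hm' : -1 < mu < 1) by lra.
  (* Since [base >= 1 - mu], a factor [(1 - mu)^(-th)] can be pulled out of the integral; what
     remains has exponent [q - th < 1/2] and is bounded. *)
  apply Rle_trans with (Rpower (1 - mu) (- th) * powint (q - th) mu).
  - unfold powint at 2.
    rewrite <- (RInt_scal (V := R_CompleteNormedModule) (fun x => Rpower (base mu x) (- (q - th)))).
    2: apply ex_RInt_Rpower_base; auto.
    apply RInt_le; [lra|apply ex_RInt_Rpower_base; auto| |].
    + apply (ex_RInt_scal (V := R_NormedModule)). apply ex_RInt_Rpower_base; auto.
    + intros x _. unfold scal; simpl; unfold mult; simpl.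
      replace (- q) with (- th + - (q - th)) by ring. rewrite Rpower_plus.
      apply Rmult_le_compat_r; [left; apply Rpower_pos|].
      assert (K := base_bounds mu x Hm'). rewrite Rabs_pos_eq in K by lra.
      apply Rpower_le_base_neg; lra.
  - rewrite Rmult_comm. apply Rmult_le_compat_r; [left; apply Rpower_pos|]. apply HP. lra.
Qed.

(** The integrand of the clock is [mass^(2 lam)], at most a constant times [(1 - lam r)^(-b)] with
    [b = 2 lam th < 1], which is integrable up to the endpoint. *)
Lemma clock_bounded_pos lam : 1 < lam ->
  exists B, forall s, 0 <= s -> dom lam s -> clock lam s <= B.
Proof.
  intros Hl. destruct (powint_upper lam Hl) as [th [B [T1 [T2 [T3 [HB HP]]]]]].
  set (b := 2 * lam * th) in *. set (A := Rpower B (2 * lam)).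
  assert (HA : 0 < A) by apply Rpower_pos.
  exists (A / (lam * (1 - b))). intros s Hs Hd.
  assert (I := derive_le_increment (clock lam)
    (fun r => - (A / (lam * (1 - b))) * Rpower (1 - lam * r) (1 - b))
    (fun r => / speed lam r) (fun r => A * Rpower (1 - lam * r) (- b)) 0 s Hs).
  rewrite clock_0, Rmult_0_r, (Rminus_0_r 1), Rpower_base_one in I.
  assert (P : 0 < A / (lam * (1 - b)) * Rpower (1 - lam * s) (1 - b)).
  { apply Rmult_lt_0_compat; [|apply Rpower_pos]. apply Rdiv_lt_0_compat; auto.
    apply Rmult_lt_0_compat; lra. }
  enough (clock lam s - 0 <= - (A / (lam * (1 - b))) * Rpower (1 - lam * s) (1 - b)
     - - (A / (lam * (1 - b))) * 1) by lra.
  apply I.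
  - intros x Hx. apply is_derive_clock. apply (dom_below lam x s Hd Hx).
  - intros x Hx. assert (D := dom_below lam x s Hd Hx). destruct D as [D1 D2].
    replace (- b) with (1 - b + - (1)) by ring.
    rewrite Rpower_plus, (Rpower_Ropp _ 1), Rpower_1 by lra.
    unfold Rpower. auto_derive; [lra|].
    change (1 + - (lam * x)) with (1 - lam * x). field. lra.
  - intros x Hx. assert (D := dom_below lam x s Hd Hx).
    assert (Pm := mass_pos lam x D).
    assert (0 <= lam * x) by (apply Rmult_le_pos; lra).
    assert (L := HP (lam * x) ltac:(destruct D; lra)). rewrite <- mass_powint in L by lra.
    unfold speed. rewrite <- Rpower_Ropp. replace (- (-2 * lam)) with (2 * lam) by ring.
    replace (A * Rpower (1 - lam * x) (- b)) with
      (Rpower (B * Rpower (1 - lam * x) (- th)) (2 * lam)).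
    + apply Rle_Rpower_l; [lra|]. split; auto.
    + rewrite <- Rpower_mult_distr by (auto; apply Rpower_pos).
      rewrite Rpower_mult. unfold A. f_equal. f_equal. unfold b. ring.
Qed.

(** Here the speed is bounded below and the parameter interval is finite. *)
Lemma clock_bounded_neg lam : lam < 0 ->
  exists B, forall s, 0 <= s -> dom lam s -> clock lam s <= B.
Proof.
  intros Hl. set (c := Rpower (1 / 4) (- 2 * lam)).
  assert (Hc : 0 < c) by apply Rpower_pos.
  exists (/ c * / (- lam)). intros s Hs Hd.
  assert (I := derive_le_increment (clock lam) (fun r => / c * r)
    (fun r => / speed lam r) (fun r => / c) 0 s Hs).
  rewrite clock_0, Rmult_0_r in I.
  assert (Hls : s <= / - lam).
  { apply Rmult_le_reg_l with (- lam); [lra|]. rewrite Rinv_r by lra. destruct Hd. lra. }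
  assert (Hic : 0 < / c) by (apply Rinv_0_lt_compat; auto).
  enough (clock lam s - 0 <= / c * s - 0).
  { assert (/ c * s <= / c * / - lam) by (apply Rmult_le_compat_l; lra). lra. }
  apply I.
  - intros x Hx. apply is_derive_clock. apply (dom_below lam x s Hd Hx).
  - intros x Hx. auto_derive; auto. ring.
  - intros x Hx. assert (D := dom_below lam x s Hd Hx).
    apply Rinv_le_contravar; auto. apply speed_lower_neg; auto. lra.
Qed.

(** Closeness to the right end of [dom] is expressed by a threshold [s1] inside the domain rather
    than by a distance, so that the increasing clock carries it over to times. *)
Definition near_end (lam : R) (Q : R -> Prop) : Prop :=
  exists s1, 0 <= s1 /\ dom lam s1 /\ forall s, dom lam s -> s1 < s -> Q s.

Lemma near_end_intro lam d (Q : R -> Prop) : lam <> 0 -> 0 < d ->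
  (forall s, dom lam s -> 0 < s -> 0 < 1 - Rabs lam * s < d -> Q s) -> near_end lam Q.
Proof.
  intros Hl Hd HQ. assert (Pl := Rabs_pos_lt lam Hl).
  (* The cap at [1] keeps the threshold nonnegative. *)
  set (e := Rmin d 1). assert (E1 : e <= d) by apply Rmin_l. assert (E2 : e <= 1) by apply Rmin_r.
  assert (E3 : 0 < e) by (apply Rmin_pos; lra).
  exists ((1 - e) / Rabs lam).
  assert (Es : Rabs lam * ((1 - e) / Rabs lam) = 1 - e) by (field; lra).
  set (s1 := (1 - e) / Rabs lam) in *.
  assert (Hs1 : 0 <= s1) by (apply Rmult_le_pos; [lra|left; apply Rinv_0_lt_compat; auto]).
  assert (Hdom : forall s, 0 <= s -> (dom lam s <-> Rabs lam * s < 1)).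
  { intros s Hs. unfold dom.
    assert (A : Rabs (lam * s) = Rabs lam * s) by (rewrite Rabs_mult, (Rabs_pos_eq s); auto).
    rewrite <- A. split; intros H; [apply Rabs_def1; lra|].
    apply Rabs_def2 in H. lra. }
  split; auto. split; [apply Hdom; lra|].
  intros s Hs Hss. assert (Hs0 : 0 < s) by lra.
  apply HQ; auto. assert (Rabs lam * s < 1) by (apply Hdom; lra || auto).
  assert (Rabs lam * s1 < Rabs lam * s) by (apply Rmult_lt_compat_l; auto). lra.
Qed.

(** * Limits of the gradient at the end of the parameter interval *)

Lemma powint_succ_le q mu : -1 < mu < 1 -> powint (q + 1) mu <= powint q mu / (1 - Rabs mu).
Proof.
  intros H. unfold Rdiv. rewrite Rmult_comm. unfold powint.
  rewrite <- (RInt_scal (V := R_CompleteNormedModule) (fun x => Rpower (base mu x) (- q))).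
  2: apply ex_RInt_Rpower_base; auto.
  apply RInt_le; [lra|apply ex_RInt_Rpower_base; auto| |].
  - apply (ex_RInt_scal (V := R_NormedModule)). apply ex_RInt_Rpower_base; auto.
  - intros x _. unfold scal; simpl; unfold mult; simpl.
    assert (K := base_bounds mu x H).
    replace (- (q + 1)) with (- q + - (1)) by ring.
    rewrite Rpower_plus, (Rpower_Ropp _ 1), Rpower_1, Rmult_comm by lra.
    apply Rmult_le_compat_r; [left; apply Rpower_pos|]. apply Rinv_le_contravar; lra.
Qed.

Lemma base_lower_pos mu x : 0 <= mu < 1 -> (1 - cos2pi x) / 2 <= base mu x.
Proof. intros H. assert (C := cos2pi_bound x). unfold base. nra. Qed.

Lemma base_lower_neg mu x : -1 < mu <= 0 -> (1 + cos2pi x) / 2 <= base mu x.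
Proof. intros H. assert (C := cos2pi_bound x). unfold base. nra. Qed.

(** Both [1 / base] and [P_(q+1) / P_q] lie between [0] and [1 / (1 - mu)], while the speed is of
    order at most [(1 - mu)^(2 - lam)]: the product is at most of order [(1 - mu)^(1 - lam)]. *)
Lemma gradient_decay lam a eta : 0 < lam < 1 -> 0 < eta ->
  near_end lam (fun s => Rabs (gradient lam a s) < eta).
Proof.
  intros Hl He. assert (Hpi := PI_RGT_0).
  set (C := (1 + 2 * PI^2)^2). assert (HC : 0 < C) by (unfold C; apply pow_lt; nra).
  destruct (Rpower_small (1 - lam) (eta / (2 * C))) as [d [Hd HS]]; [lra| |].
  { apply Rdiv_lt_0_compat; lra. }
  (* The [1/2] keeps [mu] above [1/2], so that the prefactor [1 / mu] is at most [2]. *)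
  apply (near_end_intro lam (Rmin d (1 / 2))); [lra|apply Rmin_pos; lra|].
  intros s Hs Hs0 Hn. rewrite Rabs_pos_eq in Hn by lra.
  assert (M1 := Rmin_l d (1 / 2)). assert (M2 := Rmin_r d (1 / 2)).
  rewrite gradient_powint; auto; [|lra].
  assert (SP := speed_pos lam s). assert (SU := speed_upper_pos lam s ltac:(lra) ltac:(lra) Hs).
  fold C in SU.
  set (mu := lam * s) in *. assert (Hmu : -1 < mu < 1) by exact Hs.
  assert (Bb := base_bounds mu a Hmu). rewrite Rabs_pos_eq in Bb by lra.
  assert (P := powint_pos (/ lam) mu Hmu). assert (P' := powint_pos (/ lam + 1) mu Hmu).
  assert (PS := powint_succ_le (/ lam) mu Hmu). rewrite Rabs_pos_eq in PS by lra.
  assert (Hmh : 1 / 2 < mu) by lra.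
  set (e := 1 - mu) in *.
  assert (R1 : powint (/ lam + 1) mu / powint (/ lam) mu <= / e).
  { apply Rmult_le_reg_r with (powint (/ lam) mu); auto. unfold Rdiv.
    rewrite Rmult_assoc, Rinv_l, Rmult_1_r by lra. unfold Rdiv in PS. lra. }
  assert (R0 : 0 < powint (/ lam + 1) mu / powint (/ lam) mu) by (apply Rdiv_lt_0_compat; auto).
  assert (R2 : 0 < / base mu a) by (apply Rinv_0_lt_compat; lra).
  assert (R3 : / base mu a <= / e) by (apply Rinv_le_contravar; lra).
  rewrite Rabs_mult.
  assert (A1 : Rabs (/ base mu a - powint (/ lam + 1) mu / powint (/ lam) mu) <= / e)
    by (apply Rabs_le; lra).
  assert (A2 : Rabs (speed lam s / mu) <= 2 * (C * Rpower e (2 - lam))).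
  { rewrite Rabs_pos_eq by (apply Rmult_le_pos; [lra|left; apply Rinv_0_lt_compat; lra]).
    unfold Rdiv. rewrite Rmult_comm. apply Rmult_le_compat; try lra.
    - left; apply Rinv_0_lt_compat; lra.
    - replace 2 with (/ (1 / 2)) by field. apply Rinv_le_contravar; lra. }
  apply Rle_lt_trans with (2 * (C * Rpower e (2 - lam)) * / e).
  { apply Rmult_le_compat; auto; apply Rabs_pos. }
  replace (2 - lam) with (1 - lam + 1) by ring. rewrite Rpower_plus, Rpower_1 by lra.
  replace (2 * (C * (Rpower e (1 - lam) * e)) * / e) with (Rpower e (1 - lam) * (2 * C))
    by (field; lra).
  apply Rmult_lt_reg_r with (/ (2 * C)); [apply Rinv_0_lt_compat; lra|].
  rewrite Rmult_assoc, Rinv_r, Rmult_1_r by lra. apply HS. lra.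
Qed.

(** At [q = 1] the term in [P_(q-1)] drops out of the contiguous relation, so the mean is exactly
    [s / (1 - s^2)]. The logarithmic derivative of the speed is then that of [1 - s^2], and their
    quotient is constant. *)
Lemma speed_lam1 s : 0 <= s < 1 -> speed 1 s = 1 - s^2.
Proof.
  intros Hs.
  assert (D : forall r, 0 <= r <= s -> dom 1 r) by (intros r Hr; unfold dom; lra).
  assert (Mn : forall r, 0 <= r <= s -> mass1 1 r / mass 1 r = r / (1 - r^2)).
  { intros r Hr. assert (Dr := D r Hr). assert (Pm := mass_pos 1 r Dr).
    assert (1 - r^2 <> 0) by nra.
    (* At [r = 0] the relation for [r * mass1] is void; there [mass1] is the integral of the
       cosine. *)
    destruct (Req_dec r 0) as [E|E].
    - assert (M0 : mass1 1 r = 0).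
      { transitivity (RInt (V := R_CompleteNormedModule) cos2pi 0 1);
          [|apply is_RInt_unique; apply is_RInt_cos2pi].
        unfold mass1, primitive. apply RInt_ext. intros x _. rewrite fw_base by (auto; lra).
        unfold base. rewrite E, Rmult_0_r, Rmult_0_l, Rminus_0_r, Rpower_base_one. apply Rmult_1_r. }
      rewrite M0, E. unfold Rdiv. ring.
    - assert (E1 := mass1_powint 1 r ltac:(lra) Dr).
      assert (E2 := powint_contiguous 1 (1 * r) Dr).
      rewrite mass_powint in * by lra. rewrite Rinv_1 in *.
      set (p1 := powint 1 (1 * r)) in *. set (p2 := powint (1 + 1) (1 * r)) in *.
      assert (E3 : p2 = p1 / (1 - r^2)).
      { apply Rmult_eq_reg_l with (1 - r^2); auto.
        replace ((1 - r^2) * (p1 / (1 - r^2))) with p1 by (field; auto).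
        replace ((1 * r)^2) with (r^2) in E2 by ring. lra. }
      replace (mass1 1 r) with ((p2 - p1) / r) by (rewrite <- E1; field; auto).
      rewrite E3. field. repeat split; auto; lra. }
  assert (Z : speed 1 0 / (1 - 0^2) = speed 1 s / (1 - s^2)).
  { apply (is_derive_zero_constant (fun r => speed 1 r / (1 - r^2))); [lra|].
    intros r Hr. assert (Ds := is_derive_speed 1 r (D r Hr)).
    assert (1 - r^2 <> 0) by nra.
    auto_derive.
    - split; [eexists; exact Ds|]. split; [|auto]. intros E. apply H. simpl. lra.
    - rewrite (Derive_eq (fun r : R => speed 1 r) _ _ Ds), Mn by auto.
      change (1 + - (r * (r * 1))) with (1 - r^2). field. auto. }
  assert (S0 : speed 1 0 = 1).
  { unfold speed. rewrite mass_powint by lra. rewrite Rmult_0_r.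
    replace (powint (/ 1) 0) with 1; [apply Rpower_base_one|].
    unfold powint. rewrite (RInt_ext _ (fun _ => 1)).
    - rewrite RInt_const. unfold scal; simpl; unfold mult; simpl. ring.
    - intros x _. unfold base. rewrite Rmult_0_l, Rminus_0_r. apply Rpower_base_one. }
  rewrite S0 in Z. assert (1 - s^2 <> 0) by nra.
  replace (speed 1 s) with (speed 1 s / (1 - s^2) * (1 - s^2)) by (field; auto).
  rewrite <- Z. field.
Qed.

Lemma gradient_lam1 a s : 0 < s < 1 -> gradient 1 a s = ((1 - s^2) / base s a - 1) / s.
Proof.
  intros Hs. assert (D : dom 1 s) by (unfold dom; lra).
  rewrite gradient_powint by (auto; lra). rewrite speed_lam1 by lra.
  assert (E2 := powint_contiguous 1 (1 * s) D).
  assert (P1 := powint_pos 1 (1 * s) D). assert (B := base_pos (1 * s) a D).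
  rewrite Rinv_1. rewrite !Rmult_1_l in *.
  set (p1 := powint 1 s) in *. set (p2 := powint (1 + 1) s) in *.
  assert (1 - s^2 <> 0) by nra.
  assert (E3 : p1 = (1 - s^2) * p2) by lra.
  assert (p2 <> 0) by (intros E; rewrite E in E3; lra).
  rewrite E3. field. repeat split; auto; lra.
Qed.

(** At a maximum of the initial slope [base = 1 - s], and the gradient equals [1] for every
    [0 < s < 1]. At any other label the base stays away from [0], so [(1 - s^2) / base] vanishes in
    the limit and [-1] remains. *)
Lemma gradient_limit_lam1 a eta : 0 < eta ->
  near_end 1 (fun s => Rabs (gradient 1 a s - (if Req_EM_T (cos2pi a) 1 then 1 else -1)) < eta).
Proof.
  intros He. destruct Req_EM_T as [E|E].
  - apply (near_end_intro 1 1); try lra. intros s Hs Hs0 Hn. rewrite Rabs_R1 in Hn.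
    rewrite gradient_lam1 by lra. unfold base. rewrite E.
    replace (((1 - s^2) / (1 - s * 1) - 1) / s - 1) with 0 by (field; lra).
    rewrite Rabs_R0. exact He.
  - assert (Cb := cos2pi_bound a). set (b := (1 - cos2pi a) / 2).
    assert (Hb : 0 < b) by (unfold b; lra).
    assert (Hib : 0 < / b) by (apply Rinv_0_lt_compat; auto).
    set (k := 2 * (2 * / b + 1)). assert (Hk : 0 < k) by (unfold k; lra).
    apply (near_end_intro 1 (Rmin (eta / k) (1 / 2))); [lra| |].
    { apply Rmin_pos; [apply Rdiv_lt_0_compat; auto|lra]. }
    intros s Hs Hs0 Hn. rewrite Rabs_R1, Rmult_1_l in Hn.
    assert (M1 := Rmin_l (eta / k) (1 / 2)). assert (M2 := Rmin_r (eta / k) (1 / 2)).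
    rewrite gradient_lam1 by lra.
    assert (Bl := base_lower_pos s a ltac:(lra)). fold b in Bl.
    assert (R1 : / base s a <= / b) by (apply Rinv_le_contravar; lra).
    assert (R2 : 0 < / base s a) by (apply Rinv_0_lt_compat; lra).
    replace (((1 - s^2) / base s a - 1) / s - -1) with
      ((1 - s) * (((1 + s) * / base s a - 1) * / s)) by (field; lra).
    rewrite Rabs_mult, (Rabs_pos_eq (1 - s)) by lra.
    assert (R3 : Rabs (((1 + s) * / base s a - 1) * / s) <= k).
    { rewrite Rabs_mult. unfold k. rewrite Rmult_comm. apply Rmult_le_compat; try apply Rabs_pos.
      - rewrite Rabs_pos_eq by (left; apply Rinv_0_lt_compat; lra).
        replace 2 with (/ (1 / 2)) by field. apply Rinv_le_contravar; lra.
      - assert ((1 + s) * / base s a <= 2 * / b) by (apply Rmult_le_compat; lra).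
        assert (0 <= (1 + s) * / base s a) by (apply Rmult_le_pos; lra).
        apply Rabs_le. lra. }
    apply Rle_lt_trans with ((1 - s) * k); [apply Rmult_le_compat_l; lra|].
    replace eta with (eta / k * k) by (field; lra). apply Rmult_lt_compat_r; lra.
Qed.

Lemma cos2pi_0 : cos2pi 0 = 1.
Proof. unfold cos2pi. rewrite Rmult_0_r. apply cos_0. Qed.

Lemma cos2pi_half : cos2pi (1 / 2) = -1.
Proof. unfold cos2pi. replace (2 * PI * (1 / 2)) with PI by field. apply cos_PI. Qed.

Lemma powint_ratio_div q mu : -1 < mu < 1 -> q < 1 -> q <> 0 ->
  powint (q + 1) mu / powint q mu <= / (1 - mu^2).
Proof.
  intros H Hq Hq0. assert (R := powint_ratio q mu H Hq Hq0). assert (P := powint_pos q mu H).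
  assert (0 < 1 - mu^2) by nra.
  apply Rmult_le_reg_r with (powint q mu * (1 - mu^2)); [apply Rmult_lt_0_compat; auto|].
  replace (powint (q + 1) mu / powint q mu * (powint q mu * (1 - mu^2))) with
    ((1 - mu^2) * powint (q + 1) mu) by (field; lra).
  replace (/ (1 - mu^2) * (powint q mu * (1 - mu^2))) with (powint q mu) by (field; lra).
  exact R.
Qed.

Lemma inv_lt_1 lam : 1 < lam -> 0 < / lam < 1.
Proof.
  intros H. split; [apply Rinv_0_lt_compat; lra|].
  rewrite <- Rinv_1. apply Rinv_lt_contravar; lra.
Qed.

(** The ratio bound leaves [1/(1 - mu) - 1/(1 - mu^2) = mu / (1 - mu^2)], so the gradient is at
    least [speed / (2 (1 - mu))]. The speed decays no faster than [(1 - mu)^(2 lam th)], with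
    [2 lam th < 1]. *)
Lemma gradient_max_blowup lam K : 1 < lam -> near_end lam (fun s => K < gradient lam 0 s).
Proof.
  intros Hl. assert (Hq := inv_lt_1 lam Hl).
  destruct (powint_upper lam Hl) as [th [B [T1 [T2 [T3 [HB HP]]]]]].
  set (c := Rpower B (- 2 * lam)). assert (Hc : 0 < c) by apply Rpower_pos.
  destruct (Rpower_large (2 * lam * th - 1) (2 * K / c)) as [d [Hd HL]]; [lra|].
  apply (near_end_intro lam d); [lra|lra|].
  intros s Hs Hs0 Hn. rewrite Rabs_pos_eq in Hn by lra.
  assert (Hm0 : 0 < lam * s) by (apply Rmult_lt_0_compat; lra).
  rewrite gradient_powint; auto; [|lra].
  assert (SL : c * Rpower (1 - lam * s) (2 * lam * th) <= speed lam s).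
  { replace (c * Rpower (1 - lam * s) (2 * lam * th)) with
      (Rpower (B * Rpower (1 - lam * s) (- th)) (- 2 * lam)).
    - unfold speed. rewrite mass_powint by lra. apply Rpower_le_base_neg; [|lra].
      split; [apply powint_pos; exact Hs|]. apply HP. lra.
    - rewrite <- Rpower_mult_distr by (auto; apply Rpower_pos).
      rewrite Rpower_mult. unfold c. f_equal. f_equal. ring. }
  set (mu := lam * s) in *. assert (Hmu : -1 < mu < 1) by exact Hs.
  assert (R := powint_ratio_div (/ lam) mu Hmu ltac:(lra) ltac:(lra)).
  assert (SP := speed_pos lam s).
  replace (base mu 0) with (1 - mu) by (unfold base; rewrite cos2pi_0; ring).
  assert (Hm2 : 0 < 1 - mu^2) by nra.
  apply Rlt_le_trans with (speed lam s / (2 * (1 - mu))).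
  - specialize (HL (1 - mu) ltac:(lra)).
    replace (Rpower (1 - mu) (2 * lam * th - 1)) with
      (Rpower (1 - mu) (2 * lam * th) / (1 - mu)) in HL.
    2: { unfold Rminus at 4. rewrite Rpower_plus, (Rpower_Ropp _ 1), Rpower_1 by lra. reflexivity. }
    apply Rlt_le_trans with (c * Rpower (1 - mu) (2 * lam * th) / (2 * (1 - mu))).
    + replace K with (2 * K / c * (c / 2)) by (field; lra).
      replace (c * Rpower (1 - mu) (2 * lam * th) / (2 * (1 - mu))) with
        (Rpower (1 - mu) (2 * lam * th) / (1 - mu) * (c / 2)) by (field; lra).
      apply Rmult_lt_compat_r; lra.
    + apply Rmult_le_compat_r; [left; apply Rinv_0_lt_compat; lra|exact SL].
  - apply Rle_trans with (speed lam s / mu * (/ (1 - mu) - / (1 - mu^2))).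
    + replace (speed lam s / mu * (/ (1 - mu) - / (1 - mu^2))) with (speed lam s * / (1 - mu^2)).
      2: { field. repeat split; lra. }
      apply Rmult_le_compat_l; [lra|]. apply Rinv_le_contravar; nra.
    + apply Rmult_le_compat_l; [|lra].
      apply Rmult_le_pos; [lra|left; apply Rinv_0_lt_compat; lra].
Qed.

(** Away from the maxima [1 / base] stays bounded, so the mean must win. The term
    [X = speed * P_(q+1) / P_q] equals [P_(q+1) * P_q^(-(1 + 2 lam))]; the lower bound for the first
    factor and the upper bound for [P_q] give a power of [1 - mu] that is negative by the choice of
    [th]. *)
Lemma gradient_blowdown_pos lam a K : 1 < lam -> cos2pi a < 1 ->
  near_end lam (fun s => gradient lam a s < - K).
Proof.
  intros Hl Ha. assert (Hq := inv_lt_1 lam Hl). assert (Hpi := PI_RGT_0).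
  destruct (powint_upper lam Hl) as [th [B [T1 [T2 [T3 [HB HP]]]]]].
  set (C := 1 + 2 * PI^2). assert (HC : 0 < C) by (unfold C; nra).
  set (c := Rpower C (- (/ lam + 1)) * Rpower B (- (1 + 2 * lam))).
  assert (Hc : 0 < c) by (apply Rmult_lt_0_compat; apply Rpower_pos).
  set (kb := / ((1 - cos2pi a) / 2)).
  destruct (Rpower_large (th * (1 + 2 * lam) - (/ lam + 1 / 2)) ((4 * kb + Rabs K) / c))
    as [d [Hd HL]]; [lra|].
  apply (near_end_intro lam d); [lra|lra|].
  intros s Hs Hs0 Hn. rewrite Rabs_pos_eq in Hn by lra.
  assert (Hm0 : 0 < lam * s) by (apply Rmult_lt_0_compat; lra).
  assert (Sp := speed_pos lam s). assert (Su := speed_upper lam s ltac:(lra) Hs).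
  rewrite gradient_powint; auto; [|lra].
  assert (ES : speed lam s = Rpower (powint (/ lam) (lam * s)) (- 2 * lam))
    by (unfold speed; rewrite mass_powint by lra; reflexivity).
  set (mu := lam * s) in *. assert (Hmu : -1 < mu < 1) by exact Hs.
  assert (P := powint_pos (/ lam) mu Hmu).
  assert (L := powint_lower (/ lam + 1) mu ltac:(lra) ltac:(lra)). fold C in L.
  set (X := speed lam s * (powint (/ lam + 1) mu / powint (/ lam) mu)).
  assert (HX : c * Rpower (1 - mu) (th * (1 + 2 * lam) - (/ lam + 1 / 2)) <= X).
  { replace X with (powint (/ lam + 1) mu * Rpower (powint (/ lam) mu) (- (1 + 2 * lam))).
    2: { unfold X. rewrite ES. replace (- (1 + 2 * lam)) with (- 2 * lam + - (1)) by ring.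
         rewrite Rpower_plus, (Rpower_Ropp _ 1), Rpower_1 by auto. unfold Rdiv. ring. }
    replace (c * Rpower (1 - mu) (th * (1 + 2 * lam) - (/ lam + 1 / 2))) with
      (Rpower C (- (/ lam + 1)) * Rpower (1 - mu) (1 / 2 - (/ lam + 1)) *
       Rpower (B * Rpower (1 - mu) (- th)) (- (1 + 2 * lam))).
    - apply Rmult_le_compat; auto.
      + left. apply Rmult_lt_0_compat; apply Rpower_pos.
      + left. apply Rpower_pos.
      + apply Rpower_le_base_neg; [|lra]. split; auto. apply HP. lra.
    - rewrite <- Rpower_mult_distr by (auto; apply Rpower_pos). rewrite Rpower_mult.
      replace (th * (1 + 2 * lam) - (/ lam + 1 / 2)) with
        ((1 / 2 - (/ lam + 1)) + - th * - (1 + 2 * lam)) by (field; lra).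
      rewrite Rpower_plus. unfold c. ring. }
  specialize (HL (1 - mu) ltac:(lra)).
  assert (HX2 : 4 * kb + Rabs K < X).
  { eapply Rlt_le_trans; [|exact HX].
    replace (4 * kb + Rabs K) with (c * ((4 * kb + Rabs K) / c)) by (field; lra).
    apply Rmult_lt_compat_l; auto. }
  assert (Bl := base_lower_pos mu a ltac:(lra)).
  assert (R1 : / base mu a <= kb) by (apply Rinv_le_contravar; lra).
  assert (R2 : 0 < / base mu a) by (apply Rinv_0_lt_compat; lra).
  assert (R3 : speed lam s * / base mu a <= 4 * kb) by (apply Rmult_le_compat; lra).
  replace (speed lam s / mu * (/ base mu a - powint (/ lam + 1) mu / powint (/ lam) mu)) with
    ((speed lam s * / base mu a - X) / mu).
  2: { unfold X. field. repeat split; try lra; generalize (base_pos mu a Hmu); lra. }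
  set (n := speed lam s * / base mu a - X) in *.
  assert (Hn' : n < - Rabs K) by (unfold n; lra).
  assert (n / mu <= n).
  { apply Rmult_le_reg_r with mu; auto. unfold Rdiv.
    rewrite Rmult_assoc, Rinv_l, Rmult_1_r by lra.
    assert (n <= 0) by (generalize (Rabs_pos K); lra). nra. }
  generalize (Rle_abs K). lra.
Qed.

(** The mirror image of the maximum for [lam > 1]: at label [1/2] the base is [1 + mu], the ratio
    bound gives a gradient of at most [- speed / (1 - mu^2)], and the speed is bounded below. *)
Lemma gradient_min_blowdown_neg lam K : lam < 0 ->
  near_end lam (fun s => gradient lam (1 / 2) s < - K).
Proof.
  intros Hl. set (c := Rpower (1 / 4) (- 2 * lam)). assert (Hc : 0 < c) by apply Rpower_pos.
  set (k := Rabs K + 1). assert (Hk : 0 < k) by (unfold k; generalize (Rabs_pos K); lra).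
  apply (near_end_intro lam (c / (2 * k))); [lra|apply Rdiv_lt_0_compat; lra|].
  intros s Hs Hs0 Hn. rewrite Rabs_left in Hn by lra.
  assert (Hm0 : lam * s < 0) by nra.
  assert (SL := speed_lower_neg lam s Hl ltac:(lra) Hs). fold c in SL.
  rewrite gradient_powint; auto; [|lra].
  assert (Hi : / lam < 0) by (apply Rinv_lt_0_compat; lra).
  set (mu := lam * s) in *. assert (Hmu : -1 < mu < 1) by exact Hs.
  replace (- lam * s) with (- mu) in Hn by (unfold mu; ring).
  assert (R := powint_ratio_div (/ lam) mu Hmu ltac:(lra) ltac:(lra)).
  assert (Hm2 : 0 < 1 - mu^2) by nra.
  replace (base mu (1 / 2)) with (1 + mu) by (unfold base; rewrite cos2pi_half; ring).
  apply Rle_lt_trans with (speed lam s / mu * (/ (1 + mu) - / (1 - mu^2))).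
  - assert (speed lam s / mu <= 0).
    { assert (/ mu < 0) by (apply Rinv_lt_0_compat; lra). unfold Rdiv. nra. }
    apply Rmult_le_compat_neg_l; lra.
  - replace (speed lam s / mu * (/ (1 + mu) - / (1 - mu^2))) with (- (speed lam s * / (1 - mu^2))).
    2: { field. repeat split; lra. }
    assert (E1 : / (2 * (1 + mu)) <= / (1 - mu^2)) by (apply Rinv_le_contravar; nra).
    assert (E0 : 0 < / (2 * (1 + mu))) by (apply Rinv_0_lt_compat; lra).
    assert (E2 : c * / (2 * (1 + mu)) <= speed lam s * / (1 - mu^2)).
    { apply Rmult_le_compat; lra. }
    assert (E3 : k < c * / (2 * (1 + mu))).
    { apply Rmult_lt_reg_r with (2 * (1 + mu)); [lra|].
      rewrite Rmult_assoc, Rinv_l, Rmult_1_r by lra.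
      assert (E4 : k * (1 - - mu) < k * (c / (2 * k))) by (apply Rmult_lt_compat_l; lra).
      replace (k * (c / (2 * k))) with (c / 2) in E4 by (field; lra). lra. }
    generalize (Rle_abs K). unfold k in E3. lra.
Qed.

(** For [lam <= -2] the index [q + 1] is at least [1/2], so [P_(q+1)] diverges at least
    logarithmically while [P_q <= 2]. As [mu < 0], the dominant mean pushes the gradient upwards
    wherever [1 / base] is bounded. *)
Lemma gradient_blowup_neg lam a K : lam <= -2 -> -1 < cos2pi a ->
  near_end lam (fun s => K < gradient lam a s).
Proof.
  intros Hl Ha. set (c := Rpower (1 / 4) (- 2 * lam)). assert (Hc : 0 < c) by apply Rpower_pos.
  assert (Hi : - (1 / 2) <= / lam < 0).
  { split; [|apply Rinv_lt_0_compat; lra].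
    apply Rmult_le_reg_r with (- lam); [lra|].
    replace (/ lam * - lam) with (- (1)) by (field; lra). lra. }
  set (kb := / ((1 + cos2pi a) / 2)). assert (Hkb : 0 < kb) by (apply Rinv_0_lt_compat; lra).
  set (k := Rabs K). assert (Hk : 0 <= k) by apply Rabs_pos.
  (* [12] comes from [powint_log_lower] and [2] from the bound on [P_q]; [kb] outweighs [1 / base],
     [k / c] reaches [K] after multiplication by the speed, and [1] makes the inequality strict. *)
  destruct (ln_large (12 * (2 * (kb + k / c + 1)))) as [d [Hd HL]].
  apply (near_end_intro lam d); [lra|lra|].
  intros s Hs Hs0 Hn. rewrite Rabs_left in Hn by lra.
  assert (Hm0 : lam * s < 0) by nra.
  assert (SL := speed_lower_neg lam s ltac:(lra) ltac:(lra) Hs). fold c in SL.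
  assert (MU := mass_upper_neg lam s ltac:(lra) Hs). rewrite mass_powint in MU by lra.
  rewrite gradient_powint; auto; [|lra].
  set (mu := lam * s) in *. assert (Hmu : -1 < mu < 1) by exact Hs.
  replace (- lam * s) with (- mu) in Hn by (unfold mu; ring).
  assert (P := powint_pos (/ lam) mu Hmu).
  assert (M2 : powint (/ lam) mu <= 2).
  { eapply Rle_trans; [exact MU|]. rewrite <- (Rpower_1 2) at 2 by lra.
    apply Rle_Rpower; lra. }
  assert (LL := powint_log_lower (/ lam + 1) (- mu) ltac:(lra) ltac:(lra)).
  rewrite powint_even in LL by exact Hmu. specialize (HL (1 - - mu) Hn).
  assert (R1 : kb + k / c + 1 <= powint (/ lam + 1) mu / powint (/ lam) mu).
  { apply Rmult_le_reg_r with (powint (/ lam) mu); auto. unfold Rdiv at 2.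
    rewrite Rmult_assoc, Rinv_l, Rmult_1_r by lra.
    assert (0 <= k / c) by (apply Rmult_le_pos; [auto|left; apply Rinv_0_lt_compat; auto]).
    apply Rle_trans with ((kb + k / c + 1) * 2); [apply Rmult_le_compat_l; lra|lra]. }
  assert (Bl := base_lower_neg mu a ltac:(lra)).
  assert (R2 : / base mu a <= kb) by (apply Rinv_le_contravar; lra).
  set (Y := powint (/ lam + 1) mu / powint (/ lam) mu) in *.
  replace (speed lam s / mu * (/ base mu a - Y)) with (speed lam s * (Y - / base mu a) * / (- mu)).
  2: { field. generalize (base_pos mu a Hmu); lra. }
  assert (Kc : 0 <= k / c) by (apply Rmult_le_pos; [auto|left; apply Rinv_0_lt_compat; auto]).
  assert (E1 : c * (k / c + 1) <= speed lam s * (Y - / base mu a)) by (apply Rmult_le_compat; lra).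
  replace (c * (k / c + 1)) with (k + c) in E1 by (field; lra).
  assert (E2 : 1 <= / - mu) by (rewrite <- Rinv_1 at 1; apply Rinv_le_contravar; lra).
  assert (KK := Rle_abs K). fold k in KK. nra.
Qed.

(** For [lam] in [(-2, 0)] the index [q + 1] is below [1/2], so [P_(q+1)], which dominates [mass1]
    in absolute value, is bounded. Slope and mean are estimated separately because the bound must
    hold from [s = 0] on, where [gradient_powint] would divide by [mu = 0]. *)
Lemma gradient_bounded_neg lam a : -2 < lam < 0 -> -1 < cos2pi a ->
  exists B, forall s, 0 <= s -> dom lam s -> Rabs (gradient lam a s) <= B.
Proof.
  intros Hl Ha.
  assert (Hi : / lam < - (1 / 2)).
  { apply Rmult_lt_reg_r with (- lam); [lra|].
    replace (/ lam * - lam) with (- (1)) by (field; lra). lra. }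
  destruct (powint_bounded (/ lam + 1) ltac:(lra)) as [B [HB HP]].
  set (kb := / ((1 + cos2pi a) / 2)).
  exists (4 * (kb + B * 4)). intros s Hs Hd.
  assert (Su := speed_upper lam s ltac:(lra) Hd). assert (Sp := speed_pos lam s).
  assert (Ml := mass_lower_neg lam s ltac:(lra) Hs Hd).
  assert (Hm : lam * s <= 0) by nra.
  assert (Bl := base_lower_neg (lam * s) a ltac:(destruct Hd; lra)).
  assert (Bp := base_pos (lam * s) a Hd). assert (Cb := cos2pi_bound a).
  assert (R1 : / base (lam * s) a <= kb) by (apply Rinv_le_contravar; lra).
  assert (R2 : 0 < / base (lam * s) a) by (apply Rinv_0_lt_compat; lra).
  assert (Sl : Rabs (slope lam a s) <= kb).
  { unfold slope, Rdiv. change (denom lam a s) with (base (lam * s) a).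
    rewrite Rabs_mult, (Rabs_pos_eq (/ _)) by lra.
    assert (Rabs (cos2pi a) <= 1) by (apply Rabs_le; lra).
    rewrite <- (Rmult_1_l kb). apply Rmult_le_compat; try lra. apply Rabs_pos. }
  assert (M1 : Rabs (mass1 lam s) <= B).
  { apply Rle_trans with (powint (/ lam + 1) (lam * s)); [|apply HP; exact Hd].
    assert (I1 := is_RInt_mass1 lam s Hd). assert (I2 := is_RInt_powint (/ lam + 1) _ Hd).
    apply (norm_RInt_le (V := R_NormedModule) _ _ 0 1 _ _ ltac:(lra)) with (2 := I1) (3 := I2).
    intros x _. rewrite fw_base by (auto; lra). unfold norm; simpl; unfold abs; simpl.
    rewrite Rabs_mult, (Rabs_pos_eq (Rpower _ _)) by (left; apply Rpower_pos).
    rewrite <- (Rmult_1_l (Rpower _ _)) at 2.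
    apply Rmult_le_compat_r; [left; apply Rpower_pos|]. apply Rabs_le. apply cos2pi_bound. }
  assert (Mn : Rabs (mean lam s) <= B * 4).
  { unfold mean, Rdiv. rewrite Rabs_mult, (Rabs_pos_eq (/ _)).
    2: left; apply Rinv_0_lt_compat; lra.
    apply Rmult_le_compat; auto; [apply Rabs_pos|left; apply Rinv_0_lt_compat; lra|].
    replace 4 with (/ (1 / 4)) by field. apply Rinv_le_contravar; lra. }
  unfold gradient. rewrite Rabs_mult, (Rabs_pos_eq (speed lam s)) by lra.
  apply Rmult_le_compat; try lra; [apply Rabs_pos|].
  unfold Rminus. eapply Rle_trans; [apply Rabs_triang|]. rewrite Rabs_Ropp. lra.
Qed.

(** * Time horizon and initial data *)

Definition sin_data (x : R) : R := sin (2 * PI * x) / (2 * PI).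

Lemma smooth_sin_data : smooth sin_data.
Proof.
  assert (Hpi := PI_RGT_0).
  (* Each derivative advances the phase by [PI / 2]. Order [0] stands apart since its coefficient is
     [1 / (2 PI)], not a natural power of [2 PI]. *)
  exists (fun n => match n with
    | O => sin_data
    | S m => fun x => (2 * PI)^m * sin (2 * PI * x + INR (S m) * (PI / 2))
    end).
  split; [reflexivity|]. intros n x. apply is_derive_Reals. destruct n as [|m].
  - unfold sin_data. auto_derive; auto. simpl pow. simpl INR.
    rewrite !Rmult_1_l.
    replace (2 * PI * x + PI / 2) with (PI / 2 + 2 * PI * x) by ring.
    rewrite <- cos_sin. field. lra.
  - rewrite (S_INR (S m)).
    replace (2 * PI * x + (INR (S m) + 1) * (PI / 2)) with
      (PI / 2 + (2 * PI * x + INR (S m) * (PI / 2))) by ring.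
    rewrite <- cos_sin. generalize (INR (S m)). intros r. auto_derive; auto. simpl. ring.
Qed.

Lemma is_derive_sin_data x : is_derive sin_data x (cos2pi x).
Proof.
  assert (Hpi := PI_RGT_0). unfold sin_data, cos2pi. auto_derive; auto. field. lra.
Qed.

Lemma sin_data_periodic : periodic1 sin_data.
Proof.
  intros x. unfold sin_data. f_equal. rewrite <- (sin_period (2 * PI * x) 1). f_equal.
  simpl. ring.
Qed.

Lemma is_max_pt_cos2pi a : is_max_pt cos2pi a <-> cos2pi a = 1.
Proof.
  split.
  - intros H. specialize (H 0). rewrite cos2pi_0 in H. generalize (cos2pi_bound a). lra.
  - intros H x. rewrite H. apply cos2pi_bound.
Qed.

Lemma is_min_pt_cos2pi a : is_min_pt cos2pi a <-> cos2pi a = -1.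
Proof.
  split.
  - intros H. specialize (H (1 / 2)). rewrite cos2pi_half in H. generalize (cos2pi_bound a). lra.
  - intros H x. rewrite H. apply cos2pi_bound.
Qed.

Lemma not_max_pt_cos2pi a : ~ is_max_pt cos2pi a -> cos2pi a < 1.
Proof. rewrite is_max_pt_cos2pi. generalize (cos2pi_bound a). lra. Qed.

Lemma not_min_pt_cos2pi a : ~ is_min_pt cos2pi a -> -1 < cos2pi a.
Proof. rewrite is_min_pt_cos2pi. generalize (cos2pi_bound a). lra. Qed.

Lemma finitely_many_max_cos2pi : finitely_many_in01 (is_max_pt cos2pi).
Proof.
  exists (0 :: 1 :: nil). intros a Ha. rewrite is_max_pt_cos2pi. assert (Hpi := PI_RGT_0).
  split.
  - intros H. destruct (Req_dec a 0) as [E|E]; [left; auto|].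
    destruct (Req_dec a 1) as [E'|E']; [right; left; auto|]. exfalso.
    unfold cos2pi in H. replace (2 * PI * a) with (2 * (PI * a)) in H by ring.
    rewrite cos_2a_sin in H. assert (0 < sin (PI * a)) by (apply sin_gt_0; nra). nra.
  - intros [H|[H|[]]]; subst a; [apply cos2pi_0|].
    rewrite <- (Rplus_0_l 1) at 1. rewrite cos2pi_periodic. apply cos2pi_0.
Qed.

Lemma finitely_many_min_cos2pi : finitely_many_in01 (is_min_pt cos2pi).
Proof.
  exists (1 / 2 :: nil). intros a Ha. rewrite is_min_pt_cos2pi. assert (Hpi := PI_RGT_0).
  split.
  - intros H. left.
    unfold cos2pi in H. replace (2 * PI * a) with (2 * (PI * a)) in H by ring.
    rewrite cos_2a_cos in H. assert (Z : cos (PI * a) = 0) by nra.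
    destruct (Rtotal_order a (1 / 2)) as [L|[L|L]]; auto; exfalso.
    + assert (0 < cos (PI * a)) by (apply cos_gt_0; nra). lra.
    + assert (cos (PI * a) < 0) by (apply cos_lt_0; nra). lra.
  - intros [H|[]]. subst a. apply cos2pi_half.
Qed.

Lemma is_solution_ext lam u0 v0 T u ux :
  (forall x, u0 x = v0 x) -> is_solution lam u0 T u ux -> is_solution lam v0 T u ux.
Proof.
  intros E [uxx [uxt [H0 H]]]. exists uxx, uxt. split; auto. intros x. rewrite <- E. apply H0.
Qed.

Lemma sin_data_solution lam T : in_time T 0 -> (forall t, in_time T t -> time_dom lam t) ->
  exists u ux, is_solution lam sin_data T u ux /\
    forall gamma, is_characteristic T u gamma ->
    forall a t, in_time T t -> ux (gamma a t) t = gradient lam a (param lam t).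
Proof.
  intros H0 HT.
  destruct (flow_solution T (concrete_flow lam) HT H0) as [u [ux [S G]]].
  exists u, ux. split; auto. revert S. apply is_solution_ext.
  intros x. rewrite param_0. apply initial_velocity.
Qed.

Lemma near_end_param lam Q : near_end lam Q ->
  exists s1, 0 <= s1 /\ dom lam s1 /\ forall t, time_dom lam t -> clock lam s1 < t -> Q (param lam t).
Proof.
  intros [s1 [H0 [H1 HQ]]]. exists s1. split; auto. split; auto. intros t Ht Hs.
  apply HQ; [apply param_spec; auto|apply param_gt; auto].
Qed.

Lemma clock_nonneg lam s : 0 <= s -> dom lam s -> 0 <= clock lam s.
Proof.
  intros Hs Hd. destruct (Req_dec s 0) as [E|E]; [rewrite E, clock_0; lra|].
  rewrite <- (clock_0 lam). left. apply clock_increasing; auto; [apply dom_0|lra].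
Qed.

Lemma time_dom_global lam t : 0 <= lam <= 1 -> 0 <= t -> time_dom lam t.
Proof.
  intros Hl Ht. destruct (Req_dec t 0) as [E|E].
  { exists 0. split; [apply dom_0|]. rewrite clock_0. auto. }
  assert (X : exists s, 0 <= s /\ dom lam s /\ t < clock lam s).
  { destruct (Req_dec lam 0) as [E0|E0]; [|apply clock_unbounded; lra].
    exists (t + 1). split; [lra|]. split; [unfold dom; rewrite E0; lra|].
    assert (Ec : clock lam (t + 1) = t + 1); [|lra].
    unfold clock. rewrite (RInt_ext _ (fun _ => 1)).
    - rewrite RInt_const. unfold scal; simpl; unfold mult; simpl. ring.
    - intros x _. unfold speed, Rpower. rewrite E0, Rmult_0_r, Rmult_0_l, exp_0. apply Rinv_1. }
  destruct X as [s [Hs [Hd Hc]]]. apply (time_dom_between lam 0 s); auto; [apply dom_0|].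
  rewrite clock_0. lra.
Qed.

Lemma near_end_tends lam (g : R -> R) L : 0 <= lam <= 1 ->
  (forall eta, 0 < eta -> near_end lam (fun s => Rabs (g s - L) < eta)) ->
  tends_infty (fun t => g (param lam t)) L.
Proof.
  intros Hl H eps Heps. destruct (near_end_param _ _ (H eps Heps)) as [s1 [H0 [H1 HQ]]].
  assert (C0 := clock_nonneg lam s1 H0 H1).
  exists (clock lam s1 + 1). intros t Ht. apply HQ; [|lra]. apply time_dom_global; lra.
Qed.

(** [tstar] is the supremum of the clock over nonnegative parameters. It is not attained, since the
    domain is open and the clock strictly increasing; every earlier nonnegative time is reached by
    the intermediate value theorem. *)
Lemma blowup_time lam : (exists B, forall s, 0 <= s -> dom lam s -> clock lam s <= B) ->
  exists tstar, 0 < tstar /\ (forall t, 0 <= t < tstar -> time_dom lam t) /\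
    (forall s, 0 <= s -> dom lam s -> clock lam s < tstar).
Proof.
  intros [B HB].
  destruct (completeness (fun t => exists s, 0 <= s /\ dom lam s /\ clock lam s = t)) as [T [U L]].
  - exists B. intros t [s [H1 [H2 H3]]]. subst t. auto.
  - exists (clock lam 0). exists 0. split; [lra|]. split; [apply dom_0|auto].
  - assert (Lt : forall s, 0 <= s -> dom lam s -> clock lam s < T).
    { intros s Hs Hd. destruct (open_interval_around _ s (open_dom lam) Hd) as [d Hdd].
      assert (Pd := cond_pos d).
      assert (Hd' : dom lam (s + d / 2)) by (apply Hdd; apply Rabs_def1; lra).
      apply Rlt_le_trans with (clock lam (s + d / 2)); [apply clock_increasing; auto; lra|].
      apply U. exists (s + d / 2). split; [lra|auto]. }
    exists T. split; [|split; auto].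
    + rewrite <- (clock_0 lam). apply Lt; [lra|apply dom_0].
    + intros t Ht. destruct (Req_dec t 0) as [E|E].
      { exists 0. split; [apply dom_0|]. rewrite clock_0. auto. }
      destruct (classic (exists s, 0 <= s /\ dom lam s /\ t < clock lam s)) as [[s [H1 [H2 H3]]]|N].
      * apply (time_dom_between lam 0 s); auto; [apply dom_0|]. rewrite clock_0. lra.
      * assert (T <= t); [|lra]. apply L. intros r [s [H1 [H2 H3]]]. subst r.
        destruct (Rle_dec (clock lam s) t); auto. exfalso. apply N. exists s. auto with real.
Qed.

Lemma near_end_blowup lam tstar (Q : R -> Prop) : near_end lam Q ->
  (forall t, 0 <= t < tstar -> time_dom lam t) ->
  (forall s, 0 <= s -> dom lam s -> clock lam s < tstar) ->
  exists delta, delta > 0 /\ forall t, tstar - delta < t < tstar -> 0 <= t /\ Q (param lam t).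
Proof.
  intros HQ H1 H2. destruct (near_end_param _ _ HQ) as [s1 [S0 [S1 HP]]].
  assert (C0 := clock_nonneg lam s1 S0 S1). assert (C1 := H2 s1 S0 S1).
  exists (tstar - clock lam s1). split; [lra|]. intros t Ht. split; [lra|].
  apply HP; [apply H1; lra|lra].
Qed.

Theorem mainTheorem1 :
  exists u0 u0' : R -> R,
    smooth u0 /\ periodic1 u0 /\
    (forall x, derivable_pt_lim u0 x (u0' x)) /\
    (exists a, u0' a > 0) /\ (exists a, u0' a < 0) /\
    finitely_many_in01 (is_max_pt u0') /\ finitely_many_in01 (is_min_pt u0') /\
    (* (1) *)
    (forall lam, 0 <= lam <= 1 ->
      exists u ux, is_solution lam u0 None u ux /\
        forall gamma, is_characteristic None u gamma ->
          (0 < lam < 1 ->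
             forall a, 0 <= a <= 1 -> tends_infty (fun t => ux (gamma a t) t) 0) /\
          (lam = 1 ->
             exists L : R -> R,
               (forall a, 0 <= a <= 1 -> tends_infty (fun t => ux (gamma a t) t) (L a)) /\
               exists a, 0 <= a <= 1 /\ L a <> 0)) /\
    (* (2) *)
    (forall lam, lam <= -2 \/ 1 < lam ->
      exists tstar, tstar > 0 /\ exists u ux,
        is_solution lam u0 (Some tstar) u ux /\
        forall gamma, is_characteristic (Some tstar) u gamma ->
          sup_to_pinfty tstar ux gamma /\ inf_to_minfty tstar ux gamma /\
          forall a, 0 <= a <= 1 -> ~ is_max_pt u0' a -> ~ is_min_pt u0' a ->
            abs_to_infty_left tstar (fun t => ux (gamma a t) t)) /\
    (* (3) *)
    (forall lam, -2 < lam < 0 ->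
      exists tstar, tstar > 0 /\ exists u ux,
        is_solution lam u0 (Some tstar) u ux /\
        forall gamma, is_characteristic (Some tstar) u gamma ->
          inf_to_minfty tstar ux gamma /\
          forall a, 0 <= a <= 1 -> ~ is_min_pt u0' a ->
            exists B, forall t, 0 <= t < tstar -> Rabs (ux (gamma a t) t) <= B).
Proof.
  exists sin_data, cos2pi.
  split; [exact smooth_sin_data|]. split; [exact sin_data_periodic|].
  split; [intros x; apply is_derive_Reals, is_derive_sin_data|].
  split; [exists 0; rewrite cos2pi_0; lra|].
  split; [exists (1 / 2); rewrite cos2pi_half; lra|].
  split; [exact finitely_many_max_cos2pi|]. split; [exact finitely_many_min_cos2pi|].
  split; [|split].
  - intros lam Hl.
    destruct (sin_data_solution lam None) as [u [ux [Hsol Hchar]]].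
    { split; [lra|exact I]. }
    { intros t [Ht _]. apply time_dom_global; auto. }
    exists u, ux. split; [exact Hsol|]. intros gamma Hg.
    assert (X : forall a L, tends_infty (fun t => gradient lam a (param lam t)) L ->
              tends_infty (fun t => ux (gamma a t) t) L).
    { intros a L H eps Heps. destruct (H eps Heps) as [T0 HT0].
      (* The identification of [ux] with [gradient] along characteristics holds for nonnegative
         times only. *)
      exists (Rmax 0 T0). intros t Ht.
      assert (M1 := Rmax_l 0 T0). assert (M2 := Rmax_r 0 T0).
      rewrite (Hchar gamma Hg) by (split; [lra|exact I]). apply HT0. lra. }
    split.
    + intros Hl' a _. apply X, near_end_tends; auto. intros eta He.
      destruct (gradient_decay lam a eta Hl' He) as [s1 [H0 [H1 HQ]]].
      exists s1. split; auto. split; auto. intros s Hs Hss. rewrite Rminus_0_r. auto.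
    + intros Hl1. exists (fun a => if Req_EM_T (cos2pi a) 1 then 1 else -1). split.
      * intros a _. apply X, near_end_tends; auto. intros eta He. rewrite Hl1.
        apply gradient_limit_lam1. exact He.
      * exists 0. split; [lra|]. destruct Req_EM_T; lra.
  - intros lam Hl.
    destruct (blowup_time lam) as [tstar [Hts [HT1 HT2]]].
    { destruct Hl as [Hl|Hl]; [apply clock_bounded_neg; lra|apply clock_bounded_pos; auto]. }
    exists tstar. split; auto.
    destruct (sin_data_solution lam (Some tstar)) as [u [ux [Hsol Hchar]]].
    { split; simpl; lra. }
    { intros t [Ht1 Ht2]. simpl in Ht2. apply HT1. lra. }
    exists u, ux. split; [exact Hsol|]. intros gamma Hg.
    (* Transfers an eventual property of the explicit gradient, in the parameter [s], to [ux] along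
       the given characteristic just before [tstar]. *)
    assert (X : forall a (Q : R -> Prop), near_end lam (fun s => Q (gradient lam a s)) ->
      exists delta, delta > 0 /\ forall t, tstar - delta < t < tstar -> Q (ux (gamma a t) t)).
    { intros a Q H. destruct (near_end_blowup lam tstar _ H HT1 HT2) as [d [Hd HQ]].
      exists d. split; auto. intros t Ht. destruct (HQ t Ht) as [H0 H1].
      rewrite (Hchar gamma Hg) by (split; simpl; lra). exact H1. }
    split; [|split].
    + intros K. destruct (X 0 (fun v => K < v)) as [d [Hd HQ]].
      { destruct Hl as [Hl|Hl]; [|apply gradient_max_blowup; auto].
        apply gradient_blowup_neg; auto. rewrite cos2pi_0. lra. }
      exists d. split; auto. intros t Ht. exists 0. split; [lra|]. apply HQ. exact Ht.
    + intros K. destruct (X (1 / 2) (fun v => v < - - K)) as [d [Hd HQ]].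
      { destruct Hl as [Hl|Hl]; [apply gradient_min_blowdown_neg; lra|].
        apply gradient_blowdown_pos; auto. rewrite cos2pi_half. lra. }
      exists d. split; auto. intros t Ht. exists (1 / 2). split; [lra|].
      rewrite <- (Ropp_involutive K). apply HQ. exact Ht.
    + intros a _ Hmax Hmin K. apply not_max_pt_cos2pi in Hmax. apply not_min_pt_cos2pi in Hmin.
      apply (X a (fun v => Rabs v > K)).
      destruct Hl as [Hl|Hl].
      * destruct (gradient_blowup_neg lam a K Hl Hmin) as [s1 [H0 [H1 HQ]]].
        exists s1. split; auto. split; auto. intros s Hs Hss.
        generalize (HQ s Hs Hss) (Rle_abs (gradient lam a s)). lra.
      * destruct (gradient_blowdown_pos lam a K Hl Hmax) as [s1 [H0 [H1 HQ]]].
        exists s1. split; auto. split; auto. intros s Hs Hss.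
        generalize (HQ s Hs Hss) (Rle_abs (- gradient lam a s)). rewrite Rabs_Ropp. lra.
  - intros lam Hl.
    destruct (blowup_time lam) as [tstar [Hts [HT1 HT2]]]; [apply clock_bounded_neg; lra|].
    exists tstar. split; auto.
    destruct (sin_data_solution lam (Some tstar)) as [u [ux [Hsol Hchar]]].
    { split; simpl; lra. }
    { intros t [Ht1 Ht2]. simpl in Ht2. apply HT1. lra. }
    exists u, ux. split; [exact Hsol|]. intros gamma Hg. split.
    + intros K.
      destruct (near_end_blowup lam tstar _ (gradient_min_blowdown_neg lam (- K) ltac:(lra)) HT1 HT2)
        as [d [Hd HQ]].
      exists d. split; auto. intros t Ht. exists (1 / 2). split; [lra|].
      destruct (HQ t Ht) as [H0 H1]. rewrite (Hchar gamma Hg) by (split; simpl; lra). lra.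
    + intros a _ Hmin. apply not_min_pt_cos2pi in Hmin.
      destruct (gradient_bounded_neg lam a Hl Hmin) as [B HB]. exists B. intros t Ht.
      rewrite (Hchar gamma Hg) by (split; simpl; lra).
      (* The bound on the gradient is for [s >= 0]; the parameter of a nonnegative time is
         nonnegative because the clock is increasing and vanishes at [0]. *)
      assert (Dt := HT1 t Ht). destruct (param_spec lam t Dt) as [P1 P2].
      apply HB; auto. destruct (Rle_dec 0 (param lam t)) as [L|L]; auto. exfalso.
      generalize (clock_increasing lam (param lam t) 0 P1 (dom_0 lam) ltac:(lra)).
      rewrite P2, clock_0. lra.
Qed.
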